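(* Let $(U,A)$ be a left bialgebroid such that ${}_\triangleright U$ is finitely generated projective as a left $A$-module, and let $U_*=\mathrm{Hom}_A({}_\triangleright U,A)$ be its left dual, a right bialgebroid over $A$. If $R$ is a braided commutative monoid in ${}_U\mathbf{YD}^U$ (left-right Yetter-Drinfeld modules over $U$), then $R$ (with the same multiplication and the right $U_*$-action and left $U_*$-coaction induced by the right $U$-coaction and the left $U$-action, respectively) is also a braided commutative monoid in ${}^{U_*}\mathbf{YD}_{U_*}$ (right-left Yetter-Drinfeld modules over $U_*$), and vice versa.
   Context: Let $k$ be a commutative ring; algebras are unital associative $k$-algebras. LEFT BIALGEBROIDS. A left bialgebroid $(U,A,s,t,\Delta,\varepsilon)$ over the algebra $A$ consists of an algebra $U$, algebra maps $s:A\to U$ (source) and $t:A^{op}\to U$ (target) with commuting images, and maps $\Delta,\varepsilon$ as follows. Write $a\triangleright u\triangleleft b:=s(a)t(b)u$ and $a\blacktriangleright u\blacktriangleleft b:=u\,t(a)s(b)$; triangles as subscripts indicate the module structure used. $\Delta:U\to U_\triangleleft\otimes_A{}_\triangleright U$, $u\mapsto u_{(1)}\otimes_A u_{(2)}$ (so $t(a)u\otimes_A u'=u\otimes_A s(a)u'$) and $\varepsilon:U\to A$ make ${}_\triangleright U_\triangleleft$ an $A$-coring; $\Delta$ takes values in the Takeuchi subspace of elements $\sum_i u_i\otimes_A u_i'$ with $\sum_i u_it(a)\otimes_A u'_i=\sum_i u_i\otimes_A u_i's(a)$ for all $a$, and is a unital algebra map into it; $\varepsilon(1)=1$ and $\varepsilon(uu')=\varepsilon(u\,s(\varepsilon(u')))=\varepsilon(u\,t(\varepsilon(u')))$.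 Each left $U$-module $M$ is an $A$-bimodule via $a\triangleright m\triangleleft b:=s(a)t(b)m$. A right $U$-comodule is a right $A$-module $M$ with a right $A$-linear coassociative counital coaction $\rho_M:M\to M\otimes_A{}_\triangleright U$, $m\mapsto m_{[0]}\otimes_A m_{[1]}$; with the induced left action $am:=m_{[0]}\varepsilon(m_{[1]}s(a))$ one has $\rho_M(ama')=m_{[0]}\otimes_A t(a')m_{[1]}t(a)$ and $am_{[0]}\otimes_A m_{[1]}=m_{[0]}\otimes_A m_{[1]}s(a)$. ${}_U\mathbf{YD}^U$: objects are left $U$-modules and right $U$-comodules $M$ for which the two $A$-bimodule structures coincide and $u_{(1)}m_{[0]}\otimes_A u_{(2)}m_{[1]}=(u_{(2)}m)_{[0]}\otimes_A(u_{(2)}m)_{[1]}u_{(1)}$. A monoid in ${}_U\mathbf{YD}^U$ is an object $R$ that is a unital algebra $(R,\cdot)$ with: $u(r\cdot r')=(u_{(1)}r)\cdot(u_{(2)}r')$, $u1_R=\varepsilon(u)\triangleright 1_R$; $a(r\cdot r')=(ar)\cdot r'$, $(r\cdot r')a=r\cdot(r'a)$, $(ra)\cdot r'=r\cdot(ar')$; $(r\cdot r')_{[0]}\otimes_A(r\cdot r')_{[1]}=r_{[0]}\cdot r'_{[0]}\otimes_A r'_{[1]}r_{[1]}$, $1_{[0]}\otimes_A1_{[1]}=1_R\otimes_A1_U$. It is braided commutative if $r\cdot r'=r'_{[0]}\cdot(r'_{[1]}r)$ for all $r,r'$. RIGHT BIALGEBROIDS. A right bialgebroid $(V,B,s,t,\Delta,\partial)$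 has algebra maps $s:B\to V$, $t:B^{op}\to V$ with commuting images; put $b\triangleright v\triangleleft b':=s(b)t(b')v$ and $b\blacktriangleright v\blacktriangleleft b':=v\,t(b)s(b')$; $\Delta:V\to V_\blacktriangleleft\otimes_B{}_\blacktriangleright V$, $v\mapsto v^{(1)}\otimes_B v^{(2)}$, and $\partial:V\to B$ form a $B$-coring on ${}_\blacktriangleright V_\blacktriangleleft$; $\Delta$ is a unital algebra map into the subspace where $\sum s(b)v_i\otimes v_i'=\sum v_i\otimes t(b)v'_i$; $\partial(1)=1$, $\partial(vv')=\partial(s(\partial v)v')=\partial(t(\partial v)v')$. Each right $V$-module $M$ is a $B$-bimodule via $b\blacktriangleright m\blacktriangleleft b':=m\,t(b)s(b')$. A left $V$-comodule is a left $B$-module $M$ with left $B$-linear coassociative counital coaction $M\to V_\blacktriangleleft\otimes_B M$, $m\mapsto m^{(-1)}\otimes_B m^{(0)}$; it has the induced right action $mb:=\partial(m^{(-1)}t(b))m^{(0)}$, and $m^{(-1)}\otimes_B m^{(0)}b=s(b)m^{(-1)}\otimes_B m^{(0)}$. ${}^V\mathbf{YD}_V$: objects are right $V$-modules and left $V$-comodules $M$ with coinciding $B$-bimodule structures and $m^{(-1)}v^{(1)}\otimes_B m^{(0)}v^{(2)}=v^{(2)}(mv^{(1)})^{(-1)}\otimes_B(mv^{(1)})^{(0)}$. A monoid in ${}^V\mathbf{YD}_V$ is an object $R$ that is a unital algebra with $(r\cdot r')v=(rv^{(1)})\cdot(rv^{(2)})|_{r\to r'\text{ in the second factor}}$, i.e.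 $(r\cdot r')v=(rv^{(1)})\cdot(r'v^{(2)})$, $1_Rv=1_R\blacktriangleleft\partial(v)$; $b(r\cdot r')b'=(br)\cdot(r'b')$, $(rb)\cdot r'=r\cdot(br')$; $(r\cdot r')^{(-1)}\otimes_B(r\cdot r')^{(0)}=r'^{(-1)}r^{(-1)}\otimes_B r^{(0)}\cdot r'^{(0)}$, $1^{(-1)}\otimes_B1^{(0)}=1_V\otimes_B1_R$. It is braided commutative if $r\cdot r'=(r'r^{(-1)})\cdot r^{(0)}$ for all $r,r'$. LEFT DUAL. For a left bialgebroid $(U,A)$ with ${}_\triangleright U$ finitely generated projective, $U_*:=\mathrm{Hom}_A({}_\triangleright U,A)$, with $\langle\psi,u\rangle:=\psi(u)$, is a right bialgebroid over $A$ with product $(\psi\psi')(u)=\langle\psi',\,t(\langle\psi,u_{(2)}\rangle)u_{(1)}\rangle$, unit $\varepsilon$, source $a\mapsto\varepsilon(\cdot)a$, target $a\mapsto\varepsilon(\cdot\,t(a))$, counit $\partial(\psi)=\psi(1_U)$, and coproduct determined by $\langle\psi,uu'\rangle=\langle\psi^{(2)},\,u\,s(\langle\psi^{(1)},u'\rangle)\rangle$. INDUCED STRUCTURES. Let $\{e_j\}\subset U$, $\{e^j\}\subset U_*$ be a dual basis, $u=\sum_j s(\langle e^j,u\rangle)e_j$. A right $U$-coaction and a right $U_*$-action on $R$ correspond via $r\psi=r_{[0]}\langle\psi,r_{[1]}\rangle$ (conversely $r_{[0]}\otimes_A r_{[1]}=\sum_j re^j\otimes_A e_j$); a left $U$-action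 and a left $U_*$-coaction on $R$ correspond via $r^{(-1)}\otimes_A r^{(0)}=\sum_j e^j\otimes_A e_jr$ (conversely $ur=\langle r^{(-1)},u\rangle r^{(0)}$).
   Formalization: The induced right action of a left comodule over a right bialgebroid is taken as mb := ∂(t(b)m^(-1))m^(0), as the identity m^(-1)⊗m^(0)b = s(b)m^(-1)⊗m^(0) requires; the printed ∂(m^(-1)t(b))m^(0) equals bm. *)

(* Defs.v *)
From HB Require Import structures.
From mathcomp Require Import all_boot all_algebra.
From mathcomp Require Import boolp.

Set Implicit Arguments.
Unset Strict Implicit.
Unset Printing Implicit Defensive.

Import GRing.Theory.
Local Open Scope ring_scope.
Local Open Scope quotient_scope.

Reserved Notation "m ⊗ n" (at level 40, left associativity).

(* M ⊗_A N for a right A-action mr on M and a left A-action nl on N: formal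
   sums of pairs modulo the congruence generated by the tensor relations.  The
   actions are explicit arguments because the same group carries several. *)
Section Tensor.
Variables (A : Type) (M N : zmodType) (mr : M -> A -> M) (nl : A -> N -> N).

Inductive tensor_eq : seq (M * N) -> seq (M * N) -> Prop :=
| teq_refl s : tensor_eq s s
| teq_sym s1 s2 : tensor_eq s1 s2 -> tensor_eq s2 s1
| teq_trans s1 s2 s3 : tensor_eq s1 s2 -> tensor_eq s2 s3 -> tensor_eq s1 s3
| teq_cat s1 s2 s3 s4 :
    tensor_eq s1 s2 -> tensor_eq s3 s4 -> tensor_eq (s1 ++ s3) (s2 ++ s4)
| teq_catC s1 s2 : tensor_eq (s1 ++ s2) (s2 ++ s1)
| teq_0l n : tensor_eq [:: (0, n)] [::]
| teq_Dl m1 m2 n : tensor_eq [:: (m1 + m2, n)] [:: (m1, n); (m2, n)]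
| teq_Dr m n1 n2 : tensor_eq [:: (m, n1 + n2)] [:: (m, n1); (m, n2)]
| teq_bal m a n : tensor_eq [:: (mr m a, n)] [:: (m, nl a n)].

Definition tensor_eqb : rel (seq (M * N)) := fun s1 s2 => `[< tensor_eq s1 s2 >].

Lemma tensor_eqb_refl : reflexive tensor_eqb.
Proof. by move=> s; apply/asboolP/teq_refl. Qed.

Lemma tensor_eqb_sym : symmetric tensor_eqb.
Proof. by move=> s1 s2; apply/asboolP/asboolP; apply: teq_sym. Qed.

Lemma tensor_eqb_trans : transitive tensor_eqb.
Proof.
by move=> s2 s1 s3 /asboolP h12 /asboolP h23; apply/asboolP/(teq_trans h12).
Qed.

Canonical tensor_equiv :=
  EquivRel tensor_eqb tensor_eqb_refl tensor_eqb_sym tensor_eqb_trans.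

Definition tensor := {eq_quot tensor_equiv}.
HB.instance Definition _ := Choice.on tensor.
HB.instance Definition _ := EqQuotient.on tensor.

Implicit Types T : tensor.

Lemma teqP s1 s2 : tensor_eq s1 s2 -> \pi_tensor s1 = \pi_tensor s2.
Proof. by move=> h; apply/eqmodP/asboolP. Qed.

Lemma teq_repr s : tensor_eq (repr (\pi_tensor s)) s.
Proof. by apply/asboolP; apply/(@eqmodP _ tensor_equiv); rewrite reprK. Qed.

Definition tens_add T1 T2 : tensor := \pi_tensor (repr T1 ++ repr T2).
Definition tens_opp T : tensor := \pi_tensor [seq (- p.1, p.2) | p <- repr T].

Lemma tens_addE s1 s2 : tens_add (\pi_tensor s1) (\pi_tensor s2) = \pi_tensor (s1 ++ s2).
Proof. by apply: teqP; apply: teq_cat; apply: teq_repr. Qed.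

Lemma tens_addA : associative tens_add.
Proof.
move=> T1 T2 T3; rewrite -[T1]reprK -[T2]reprK -[T3]reprK.
set s1 := repr T1; set s2 := repr T2; set s3 := repr T3.
by rewrite (tens_addE s2 s3) (tens_addE s1 s2) 2!tens_addE catA.
Qed.

Lemma tens_addC : commutative tens_add.
Proof.
move=> T1 T2; rewrite -[T1]reprK -[T2]reprK !(tens_addE (repr _)).
by apply/teqP/teq_catC.
Qed.

Lemma tens_add0 : left_id (\pi_tensor [::]) tens_add.
Proof. by move=> T; rewrite -[T]reprK (tens_addE [::]). Qed.

Lemma tens_addN : left_inverse (\pi_tensor [::]) tens_opp tens_add.
Proof.
move=> T; rewrite /tens_opp -[X in tens_add _ X]reprK tens_addE; apply: teqP.
elim: (repr T) => [|[m n] s IHs] /=; first exact: teq_refl.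
have h1 : tensor_eq ([:: (- m, n)] ++ [:: (m, n)]) [::].
  by apply: teq_trans (teq_0l n); rewrite -(addNr m); apply/teq_sym/teq_Dl.
rewrite -cat1s -[(m, n) :: s]cat1s.
set s' := map _ s in IHs *.
apply: (teq_trans (s2 := ([:: (-m, n)] ++ [:: (m, n)]) ++ (s' ++ s))).
  rewrite -!catA; apply: teq_cat; first exact: teq_refl.
  by rewrite !catA; apply: teq_cat; [apply: teq_catC|apply: teq_refl].
exact: (teq_cat h1 IHs).
Qed.

HB.instance Definition _ :=
  GRing.isZmodule.Build tensor tens_addA tens_addC tens_add0 tens_addN.

Definition tens (m : M) (n : N) : tensor := \pi_tensor [:: (m, n)].

(* The map on M ⊗_A N induced by f, computed on a representative: meaningful
   only when f is balanced (see tlift_tens below). *)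
Definition tlift (Z : zmodType) (f : M -> N -> Z) T : Z :=
  \sum_(p <- repr T) f p.1 p.2.

Lemma tens_cat s1 s2 : \pi_tensor (s1 ++ s2) = \pi_tensor s1 + \pi_tensor s2.
Proof. by rewrite -tens_addE. Qed.

Lemma tens_sum s : \pi_tensor s = \sum_(p <- s) tens p.1 p.2.
Proof.
elim: s => [|[m n] s IHs]; first by rewrite big_nil.
by rewrite big_cons -cat1s tens_cat IHs.
Qed.

Lemma tensDl m1 m2 n : tens (m1 + m2) n = tens m1 n + tens m2 n.
Proof. by rewrite -tens_cat; apply/teqP/teq_Dl. Qed.

Lemma tensDr m n1 n2 : tens m (n1 + n2) = tens m n1 + tens m n2.
Proof. by rewrite -tens_cat; apply/teqP/teq_Dr. Qed.

Lemma tens_bal m a n : tens (mr m a) n = tens m (nl a n).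
Proof. exact/teqP/teq_bal. Qed.

Lemma tens_suml I (r : seq I) (F : I -> M) n :
  tens (\sum_(i <- r) F i) n = \sum_(i <- r) tens (F i) n.
Proof.
apply: (big_morph (tens^~ n)) => [x y|]; first exact: tensDl.
by apply: (addrI (tens 0 n)); rewrite -tensDl !addr0.
Qed.

Lemma tens_sumr I (r : seq I) (F : I -> N) m :
  tens m (\sum_(i <- r) F i) = \sum_(i <- r) tens m (F i).
Proof.
apply: (big_morph (tens m)) => [x y|]; first exact: tensDr.
by apply: (addrI (tens m 0)); rewrite -tensDr !addr0.
Qed.

Lemma tlift_repr T : tlift tens T = T.
Proof. by rewrite -[RHS]reprK tens_sum. Qed.

Record balanced (Z : zmodType) (f : M -> N -> Z) : Prop := Balanced {
  balDl : forall m1 m2 n, f (m1 + m2) n = f m1 n + f m2 n;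
  balDr : forall m n1 n2, f m (n1 + n2) = f m n1 + f m n2;
  balA : forall m a n, f (mr m a) n = f m (nl a n) }.

Lemma balanced_tens : balanced tens.
Proof. by split; [apply: tensDl|apply: tensDr|apply: tens_bal]. Qed.

Section Lift.
Variables (Z : zmodType) (f : M -> N -> Z) (fb : balanced f).

Lemma tensor_eq_sum s1 s2 : tensor_eq s1 s2 ->
  \sum_(p <- s1) f p.1 p.2 = \sum_(p <- s2) f p.1 p.2.
Proof.
have f0 n : f 0 n = 0.
  by apply: (addrI (f 0 n)); rewrite -(balDl fb) !addr0.
elim=> {s1 s2} // [s1 s2 s3 _ -> _ ->|s1 s2 s3 s4 _ h1 _ h2|s1 s2|n|m1 m2 n|m n1 n2|m a n] //.
- by rewrite !big_cat /= h1 h2.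
- by rewrite !big_cat /= addrC.
- by rewrite big_cons big_nil /= f0 addr0.
- by rewrite !big_cons big_nil /= (balDl fb) !addr0.
- by rewrite !big_cons big_nil /= (balDr fb) !addr0.
- by rewrite !big_cons big_nil /= (balA fb).
Qed.

Lemma tlift_pi s : tlift f (\pi_tensor s) = \sum_(p <- s) f p.1 p.2.
Proof. exact/tensor_eq_sum/teq_repr. Qed.

Lemma tlift_tens m n : tlift f (tens m n) = f m n.
Proof. by rewrite tlift_pi big_cons big_nil addr0. Qed.

Lemma tliftD T1 T2 : tlift f (T1 + T2) = tlift f T1 + tlift f T2.
Proof. by rewrite -(reprK T1) -(reprK T2) -tens_cat !tlift_pi big_cat. Qed.

Lemma tlift0 : tlift f 0 = 0.
Proof. by apply: (addrI (tlift f 0)); rewrite -tliftD !addr0. Qed.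

Lemma tlift_sum I (r : seq I) (F : I -> tensor) :
  tlift f (\sum_(i <- r) F i) = \sum_(i <- r) tlift f (F i).
Proof. exact: (big_morph _ tliftD tlift0). Qed.

End Lift.

Lemma eq_tlift (Z : zmodType) (f g : M -> N -> Z) T :
  (forall m n, f m n = g m n) -> tlift f T = tlift g T.
Proof. by move=> fg; apply: eq_bigr => p _; apply: fg. Qed.

Lemma tlift_unique (Z : zmodType) (f : M -> N -> Z) (F : tensor -> Z) :
    (forall T1 T2, F (T1 + T2) = F T1 + F T2) ->
    (forall m n, F (tens m n) = f m n) ->
  forall T, F T = tlift f T.
Proof.
move=> FD Ff T; have F0 : F 0 = 0.
  by apply: (addrI (F 0)); rewrite -FD !addr0.
rewrite -[T in LHS]reprK tens_sum (big_morph F FD F0).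
by apply: eq_bigr => p _; apply: Ff.
Qed.

End Tensor.

Lemma tlift_tlift (A A' : Type) (M N M' N' Z : zmodType) (mr : M -> A -> M)
    (nl : A -> N -> N) (mr' : M' -> A' -> M')
    (nl' : A' -> N' -> N')
    (f : M -> N -> Z) (g : M' -> N' -> tensor mr nl) (T : tensor mr' nl') :
  balanced mr nl f -> tlift f (tlift g T) = tlift (fun m n => tlift f (g m n)) T.
Proof. by move=> fb; rewrite [LHS](tlift_sum fb). Qed.

Lemma morph_tlift (A : Type) (M N Z Z' : zmodType) (mr : M -> A -> M)
    (nl : A -> N -> N) (F : Z -> Z') (f : M -> N -> Z) (T : tensor mr nl) :
  {morph F : x y / x + y} -> F (tlift f T) = tlift (fun m n => F (f m n)) T.
Proof.
move=> FD; apply: big_morph => //.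
by apply: (addrI (F 0)); rewrite -FD !addr0.
Qed.

Lemma tlift_exchange (A A' : Type) (M N M' N' Z : zmodType) (mr : M -> A -> M)
    (nl : A -> N -> N) (mr' : M' -> A' -> M') (nl' : A' -> N' -> N')
    (f : M -> N -> M' -> N' -> Z) (T : tensor mr nl) (T' : tensor mr' nl') :
  tlift (fun m n => tlift (f m n) T') T =
  tlift (fun m' n' => tlift (fun m n => f m n m' n') T) T'.
Proof. exact: exchange_big. Qed.

Lemma tlift_split (A : Type) (M N Z : zmodType) (mr : M -> A -> M)
    (nl : A -> N -> N) (f g : M -> N -> Z) (T : tensor mr nl) :
  tlift (fun m n => f m n + g m n) T = tlift f T + tlift g T.
Proof. exact: big_split. Qed.

Arguments tens {A M N mr nl} m n.
Arguments tlift {A M N mr nl Z} f T.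
Notation "m ⊗ n" := (tens m n) : ring_scope.

Definition tensl (A B : Type) (M N : zmodType) (mr : M -> A -> M)
    (nl : A -> N -> N) (ml : B -> M -> M) (b : B) (T : tensor mr nl) :
  tensor mr nl := tlift (fun m n => ml b m ⊗ n) T.
Arguments tensl {A B M N mr nl} ml b T.

(* The actions a ▷ u, u ◁ a, a ▶ u and u ◀ a given by a source map s and a
   target map t. *)
Section Actions.
Variables (A : Type) (U : pzRingType).
Definition tri_l (s : A -> U) (a : A) (u : U) : U := s a * u.
Definition tri_r (t : A -> U) (u : U) (a : A) : U := t a * u.
Definition btri_l (t : A -> U) (a : A) (u : U) : U := u * t a.
Definition btri_r (s : A -> U) (u : U) (a : A) : U := u * s a.
End Actions.

Section Modules.
Variables (k : comPzRingType) (A : algType k) (M : lmodType k).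

Record is_left_module (act : A -> M -> M) : Prop := IsLeftModule {
  lmodA1 : forall m, act 1 m = m;
  lmodAM : forall a b m, act (a * b) m = act a (act b m);
  lmodADr : forall a m m', act a (m + m') = act a m + act a m';
  lmodADl : forall a b m, act (a + b) m = act a m + act b m;
  lmodAZ : forall (c : k) a m, act (c *: a) m = c *: act a m }.

Record is_right_module (act : M -> A -> M) : Prop := IsRightModule {
  rmodA1 : forall m, act m 1 = m;
  rmodAM : forall m a b, act m (a * b) = act (act m a) b;
  rmodADl : forall m m' a, act (m + m') a = act m a + act m' a;
  rmodADr : forall m a b, act m (a + b) = act m a + act m b;
  rmodAZ : forall (c : k) m a, act m (c *: a) = c *: act m a }.

End Modules.

(* In iterated sums over Sweedler components, the order of nesting is chosen
   so that every function under tlift is balanced. *)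
Record left_bialgebroid (k : comPzRingType) (A U : algType k) :=
  LeftBialgebroid {
  lsrc : {lrmorphism A -> U};
  ltgt : {linear A -> U};
  ltgt_morph : monoid_morphism (ltgt : A^c -> U);
  lsrc_tgt : forall a b, lsrc a * ltgt b = ltgt b * lsrc a;
  lcoprod : {additive U -> tensor (tri_r ltgt) (tri_l lsrc)};
  lcounit : {additive U -> A};
  lcoprod_bimod : forall a b u,
    lcoprod (lsrc a * ltgt b * u) =
    tlift (fun x y => (lsrc a * x) ⊗ (ltgt b * y)) (lcoprod u);
  lcounit_bimod : forall a b u,
    lcounit (lsrc a * ltgt b * u) = a * lcounit u * b;
  lcoassoc : forall u,
    tlift (fun x y => tlift (fun x1 x2 => x1 ⊗ (x2 ⊗ y)) (lcoprod x))
          (lcoprod u) =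
    tlift (fun x y => x ⊗ lcoprod y) (lcoprod u)
      :> tensor (tri_r ltgt) (tensl (tri_l lsrc));
  lcounitl : forall u,
    tlift (fun x y => lsrc (lcounit x) * y) (lcoprod u) = u;
  lcounitr : forall u,
    tlift (fun x y => ltgt (lcounit y) * x) (lcoprod u) = u;
  lcoprod_takeuchi : forall u a,
    tlift (fun x y => (x * ltgt a) ⊗ y) (lcoprod u) =
    tlift (fun x y => x ⊗ (y * lsrc a)) (lcoprod u)
      :> tensor (tri_r ltgt) (tri_l lsrc);
  lcoprod1 : lcoprod 1 = 1 ⊗ 1;
  lcoprodM : forall u v,
    lcoprod (u * v) =
    tlift (fun v1 v2 => tlift (fun u1 u2 => (u1 * v1) ⊗ (u2 * v2)) (lcoprod u))
          (lcoprod v);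
  lcounit1 : lcounit 1 = 1;
  lcounitM_src : forall u v, lcounit (u * v) = lcounit (u * lsrc (lcounit v));
  lcounitM_tgt : forall u v, lcounit (u * v) = lcounit (u * ltgt (lcounit v)) }.

Record right_bialgebroid (k : comPzRingType) (B V : algType k) :=
  RightBialgebroid {
  rsrc : {lrmorphism B -> V};
  rtgt : {linear B -> V};
  rtgt_morph : monoid_morphism (rtgt : B^c -> V);
  rsrc_tgt : forall a b, rsrc a * rtgt b = rtgt b * rsrc a;
  rcoprod : {additive V -> tensor (btri_r rsrc) (btri_l rtgt)};
  rcounit : {additive V -> B};
  rcoprod_bimod : forall a b v,
    rcoprod (v * rtgt a * rsrc b) =
    tlift (fun x y => (x * rtgt a) ⊗ (y * rsrc b)) (rcoprod v);
  rcounit_bimod : forall a b v,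
    rcounit (v * rtgt a * rsrc b) = a * rcounit v * b;
  rcoassoc : forall v,
    tlift (fun x y => tlift (fun x1 x2 => x1 ⊗ (x2 ⊗ y)) (rcoprod x))
          (rcoprod v) =
    tlift (fun x y => x ⊗ rcoprod y) (rcoprod v)
      :> tensor (btri_r rsrc) (tensl (btri_l rtgt));
  rcounitl : forall v,
    tlift (fun x y => y * rtgt (rcounit x)) (rcoprod v) = v;
  rcounitr : forall v,
    tlift (fun x y => x * rsrc (rcounit y)) (rcoprod v) = v;
  rcoprod_takeuchi : forall v b,
    tlift (fun x y => (rsrc b * x) ⊗ y) (rcoprod v) =
    tlift (fun x y => x ⊗ (rtgt b * y)) (rcoprod v)
      :> tensor (btri_r rsrc) (btri_l rtgt);
  rcoprod1 : rcoprod 1 = 1 ⊗ 1;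
  rcoprodM : forall v w,
    rcoprod (v * w) =
    tlift (fun v1 v2 => tlift (fun w1 w2 => (v1 * w1) ⊗ (v2 * w2)) (rcoprod w))
          (rcoprod v);
  rcounit1 : rcounit 1 = 1;
  rcounitM_src : forall v w, rcounit (v * w) = rcounit (rsrc (rcounit v) * w);
  rcounitM_tgt : forall v w, rcounit (v * w) = rcounit (rtgt (rcounit v) * w) }.

Section LeftRightYD.
Variables (k : comPzRingType) (A U : algType k) (L : left_bialgebroid A U).
Local Notation s := (lsrc L).
Local Notation t := (ltgt L).

Record is_right_comodule (M : lmodType k) (ract : M -> A -> M)
    (coact : M -> tensor ract (tri_l s)) : Prop := IsRightComodule {
  rcomod_module : is_right_module ract;
  rcoactD : forall m m', coact (m + m') = coact m + coact m';
  rcoact_lin : forall m a,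
    coact (ract m a) = tlift (fun m0 m1 => m0 ⊗ (t a * m1)) (coact m);
  rcoact_coassoc : forall m,
    tlift (fun m0 m1 => tlift (fun n0 n1 => n0 ⊗ (n1 ⊗ m1)) (coact m0))
          (coact m) =
    tlift (fun m0 m1 => m0 ⊗ lcoprod L m1) (coact m)
      :> tensor ract (tensl (tri_l s));
  rcoact_counit : forall m,
    tlift (fun m0 m1 => ract m0 (lcounit L m1)) (coact m) = m }.

Definition comod_lact (M : lmodType k) (ract : M -> A -> M)
    (coact : M -> tensor ract (tri_l s)) (a : A) (m : M) : M :=
  tlift (fun m0 m1 => ract m0 (lcounit L (m1 * s a))) (coact m).

Record lr_data (M : lmodType k) := LRData {
  lr_act : U -> M -> M;
  lr_ract : M -> A -> M;
  lr_coact : M -> tensor lr_ract (tri_l s) }.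

Record is_lr_YD (M : lmodType k) (D : lr_data M) : Prop := IsLRYD {
  lr_module : is_left_module (lr_act D);
  lr_comodule : is_right_comodule (lr_coact D);
  lr_bimod_l : forall a m, lr_act D (s a) m = comod_lact (lr_coact D) a m;
  lr_bimod_r : forall a m, lr_act D (t a) m = lr_ract D m a;
  lr_YD : forall u m,
    tlift (fun m0 m1 =>
        tlift (fun u1 u2 => lr_act D u1 m0 ⊗ (u2 * m1)) (lcoprod L u))
      (lr_coact D m) =
    tlift (fun u1 u2 =>
        tlift (fun n0 n1 => n0 ⊗ (n1 * u1)) (lr_coact D (lr_act D u2 m)))
      (lcoprod L u)
      :> tensor (lr_ract D) (tri_l s) }.

Record is_lr_monoid (R : algType k) (D : lr_data R) : Prop := IsLRMonoid {
  lr_monoid_YD : is_lr_YD D;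
  lr_actM : forall u r r',
    lr_act D u (r * r') =
    tlift (fun u1 u2 => lr_act D u1 r * lr_act D u2 r') (lcoprod L u);
  lr_act1 : forall u, lr_act D u 1 = lr_act D (s (lcounit L u)) 1;
  lr_bilinl : forall a r r', lr_act D (s a) (r * r') = lr_act D (s a) r * r';
  lr_bilinr : forall a r r', lr_ract D (r * r') a = r * lr_ract D r' a;
  lr_balance : forall a r r', lr_ract D r a * r' = r * lr_act D (s a) r';
  lr_coactM : forall r r',
    lr_coact D (r * r') =
    tlift (fun r0 r1 =>
        tlift (fun r0' r1' => (r0 * r0') ⊗ (r1' * r1)) (lr_coact D r'))
      (lr_coact D r);
  lr_coact1 : lr_coact D 1 = 1 ⊗ 1 }.

Definition lr_braided_commutative (R : algType k) (D : lr_data R) : Prop :=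
  forall r r', r * r' = tlift (fun r0' r1' => r0' * lr_act D r1' r) (lr_coact D r').

End LeftRightYD.

Section RightLeftYD.
Variables (k : comPzRingType) (B V : algType k) (W : right_bialgebroid B V).
Local Notation s := (rsrc W).
Local Notation t := (rtgt W).

Record is_left_comodule (M : lmodType k) (lact : B -> M -> M)
    (coact : M -> tensor (btri_r s) lact) : Prop := IsLeftComodule {
  lcomod_module : is_left_module lact;
  lcoactD : forall m m', coact (m + m') = coact m + coact m';
  lcoact_lin : forall b m,
    coact (lact b m) = tlift (fun m1 m0 => (m1 * t b) ⊗ m0) (coact m);
  lcoact_coassoc : forall m,
    tlift (fun m1 m0 => tlift (fun v1 v2 => v1 ⊗ (v2 ⊗ m0)) (rcoprod W m1))
          (coact m) =
    tlift (fun m1 m0 => m1 ⊗ coact m0) (coact m)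
      :> tensor (btri_r s) (tensl (btri_l t));
  lcoact_counit : forall m,
    tlift (fun m1 m0 => lact (rcounit W m1) m0) (coact m) = m }.

(* m b := counit(t(b) m^(-1)) m^(0), the right action for which
   m^(-1) ⊗ m^(0) b = s(b) m^(-1) ⊗ m^(0); with t(b) on the other side of
   m^(-1) the formula would return the left action b m. *)
Definition comod_ract (M : lmodType k) (lact : B -> M -> M)
    (coact : M -> tensor (btri_r s) lact) (m : M) (b : B) : M :=
  tlift (fun m1 m0 => lact (rcounit W (t b * m1)) m0) (coact m).

Record rl_data (M : lmodType k) := RLData {
  rl_act : M -> V -> M;
  rl_lact : B -> M -> M;
  rl_coact : M -> tensor (btri_r s) rl_lact }.

Record is_rl_YD (M : lmodType k) (D : rl_data M) : Prop := IsRLYD {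
  rl_module : is_right_module (rl_act D);
  rl_comodule : is_left_comodule (rl_coact D);
  rl_bimod_l : forall b m, rl_act D m (t b) = rl_lact D b m;
  rl_bimod_r : forall b m, rl_act D m (s b) = comod_ract (rl_coact D) m b;
  rl_YD : forall m v,
    tlift (fun m1 m0 =>
        tlift (fun v1 v2 => (m1 * v1) ⊗ rl_act D m0 v2) (rcoprod W v))
      (rl_coact D m) =
    tlift (fun v1 v2 =>
        tlift (fun n1 n0 => (v2 * n1) ⊗ n0) (rl_coact D (rl_act D m v1)))
      (rcoprod W v)
      :> tensor (btri_r s) (rl_lact D) }.

Record is_rl_monoid (R : algType k) (D : rl_data R) : Prop := IsRLMonoid {
  rl_monoid_YD : is_rl_YD D;
  rl_actM : forall r r' v,
    rl_act D (r * r') v =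
    tlift (fun v1 v2 => rl_act D r v1 * rl_act D r' v2) (rcoprod W v);
  rl_act1 : forall v, rl_act D 1 v = rl_act D 1 (s (rcounit W v));
  rl_bilin : forall b b' r r',
    rl_act D (rl_lact D b (r * r')) (s b') = rl_lact D b r * rl_act D r' (s b');
  rl_balance : forall b r r', rl_act D r (s b) * r' = r * rl_lact D b r';
  rl_coactM : forall r r',
    rl_coact D (r * r') =
    tlift (fun r1' r0' =>
        tlift (fun r1 r0 => (r1' * r1) ⊗ (r0 * r0')) (rl_coact D r))
      (rl_coact D r');
  rl_coact1 : rl_coact D 1 = 1 ⊗ 1 }.

Definition rl_braided_commutative (R : algType k) (D : rl_data R) : Prop :=
  forall r r', r * r' = tlift (fun r1 r0 => rl_act D r' r1 * r0) (rl_coact D r).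

End RightLeftYD.

(* Direct summand of a finite free module. *)
Definition is_fgp (A : pzRingType) (M : lmodType A) : Prop :=
  exists (n : nat) (i : {linear M -> 'rV[A]_n}) (p : {linear 'rV[A]_n -> M}),
    cancel i p.

(* U as the left A-module with a ▷ u = s(a) u. *)
Definition src_mod (k : comPzRingType) (A U : algType k)
  (L : left_bialgebroid A U) : Type := U.

Section SrcMod.
Variables (k : comPzRingType) (A U : algType k) (L : left_bialgebroid A U).
Local Notation act := (tri_l (lsrc L) : A -> src_mod L -> src_mod L).

HB.instance Definition _ := GRing.Zmodule.copy (src_mod L) U.

Lemma src_modA a b u : act a (act b u) = act (a * b) u.
Proof. by rewrite /tri_l mulrA rmorphM. Qed.
Lemma src_mod1 : left_id 1 act.
Proof. by move=> u; rewrite /tri_l rmorph1 mul1r. Qed.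
Lemma src_modDr : right_distributive act +%R.
Proof. by move=> a u v; rewrite /tri_l mulrDr. Qed.
Lemma src_modDl u : {morph act^~ u : a b / a + b}.
Proof. by move=> a b; rewrite /tri_l rmorphD mulrDl. Qed.

HB.instance Definition _ := GRing.Zmodule_isLmodule.Build A (src_mod L)
  src_modA src_mod1 src_modDr src_modDl.
End SrcMod.

Section Theory.
Variables (k : comPzRingType) (A U : algType k) (L : left_bialgebroid A U).
Local Notation s := (lsrc L).
Local Notation t := (ltgt L).
Local Notation Delta := (lcoprod L).
Local Notation eps := (lcounit L).

Lemma ltgt1 : t 1 = 1.
Proof. by case: (ltgt_morph L). Qed.
Lemma ltgtM a b : t (a * b) = t b * t a.
Proof. by case: (ltgt_morph L) => _ h; apply: h. Qed.
Lemma lcounit_src a u : eps (s a * u) = a * eps u.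
Proof. by have := lcounit_bimod L a 1 u; rewrite ltgt1 !mulr1. Qed.
Lemma lcounit_tgt a u : eps (t a * u) = eps u * a.
Proof. by have := lcounit_bimod L 1 a u; rewrite rmorph1 !mul1r. Qed.

Lemma lcounit_mul_tgt u a : eps (u * t a) = eps (u * s a).
Proof.
by rewrite lcounitM_src -[t a]mulr1 lcounit_tgt lcounit1 mul1r.
Qed.

Lemma lcoprod_src a u :
  Delta (s a * u) = tlift (fun x y => (s a * x) ⊗ y) (Delta u).
Proof.
have := lcoprod_bimod L a 1 u; rewrite ltgt1 mulr1 => ->.
by apply: eq_tlift => x y; rewrite mul1r.
Qed.

Lemma lcoprod_tgt a u :
  Delta (t a * u) = tlift (fun x y => x ⊗ (t a * y)) (Delta u).
Proof.
have := lcoprod_bimod L 1 a u; rewrite rmorph1 mul1r => ->.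
by apply: eq_tlift => x y; rewrite mul1r.
Qed.

Local Notation UU := (tensor (tri_r t) (tri_l s)).

Lemma bal_coprodM_in (v1 v2 : U) : balanced (tri_r t) (tri_l s)
  (fun u1 u2 => (u1 * v1) ⊗ (u2 * v2) : UU).
Proof.
split=> [x y z|x y z|x a y]; rewrite ?mulrDl ?tensDl ?tensDr //.
by rewrite /tri_l /tri_r -!mulrA; apply: tens_bal.
Qed.

Lemma bal_coprodM_out u : balanced (tri_r t) (tri_l s)
  (fun v1 v2 => tlift (fun u1 u2 => (u1 * v1) ⊗ (u2 * v2)) (Delta u) : UU).
Proof.
split=> [x y z|x y z|x a y].
- by rewrite -tlift_split; apply: eq_tlift => m n; rewrite mulrDr tensDl.
- by rewrite -tlift_split; apply: eq_tlift => m n; rewrite mulrDr tensDr.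
- have := congr1 (tlift (fun u1 u2 => (u1 * x) ⊗ (u2 * y) : UU))
    (lcoprod_takeuchi L u a).
  rewrite !(tlift_tlift _ _ (bal_coprodM_in _ _)) => h.
  transitivity (tlift (fun u1 u2 =>
    tlift (fun v1 v2 => (v1 * x) ⊗ (v2 * y) : UU) ((u1 * t a) ⊗ u2 : UU))
    (Delta u)).
    apply: eq_tlift => m n.
    by rewrite (tlift_tens (bal_coprodM_in _ _)) /tri_r mulrA.
  rewrite h; apply: eq_tlift => m n.
  by rewrite (tlift_tens (bal_coprodM_in _ _)) /tri_l mulrA.
Qed.

Lemma lcoprodM_src a u :
  Delta (u * s a) = tlift (fun x y => (x * s a) ⊗ y) (Delta u).
Proof.
rewrite lcoprodM -[s a in LHS]mulr1 lcoprod_src lcoprod1.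
rewrite (tlift_tlift _ _ (bal_coprodM_out _)).
rewrite tlift_tens; last first.
  split=> [x y z|x y z|x b y].
  - by rewrite mulrDr tensDl (tliftD (bal_coprodM_out _)).
  - by rewrite tensDr (tliftD (bal_coprodM_out _)).
  - by rewrite /tri_r mulrA lsrc_tgt -mulrA tens_bal.
rewrite (tlift_tens (bal_coprodM_out _)).
by apply: eq_tlift => x y; rewrite !mulr1.
Qed.

Lemma lcoprodM_tgt a u :
  Delta (u * t a) = tlift (fun x y => x ⊗ (y * t a)) (Delta u).
Proof.
rewrite lcoprodM -[t a in LHS]mulr1 lcoprod_tgt lcoprod1.
rewrite (tlift_tlift _ _ (bal_coprodM_out _)).
rewrite tlift_tens; last first.
  split=> [x y z|x y z|x b y].
  - by rewrite tensDl (tliftD (bal_coprodM_out _)).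
  - by rewrite mulrDr tensDr (tliftD (bal_coprodM_out _)).
  - by rewrite tens_bal /tri_l !mulrA lsrc_tgt.
rewrite (tlift_tens (bal_coprodM_out _)).
by apply: eq_tlift => x y; rewrite !mulr1.
Qed.

Section Eval.
Variables (Z : zmodType) (f : U -> U -> Z).
Hypothesis fb : balanced (tri_r t) (tri_l s) f.

Lemma ev_src a u :
  tlift f (Delta (s a * u)) = tlift (fun x y => f (s a * x) y) (Delta u).
Proof.
rewrite lcoprod_src (tlift_tlift _ _ fb).
by apply: eq_tlift => x y; rewrite (tlift_tens fb).
Qed.

Lemma ev_tgt a u :
  tlift f (Delta (t a * u)) = tlift (fun x y => f x (t a * y)) (Delta u).
Proof.
rewrite lcoprod_tgt (tlift_tlift _ _ fb).
by apply: eq_tlift => x y; rewrite (tlift_tens fb).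
Qed.

Lemma ev_Msrc a u :
  tlift f (Delta (u * s a)) = tlift (fun x y => f (x * s a) y) (Delta u).
Proof.
rewrite lcoprodM_src (tlift_tlift _ _ fb).
by apply: eq_tlift => x y; rewrite (tlift_tens fb).
Qed.

Lemma ev_Mtgt a u :
  tlift f (Delta (u * t a)) = tlift (fun x y => f x (y * t a)) (Delta u).
Proof.
rewrite lcoprodM_tgt (tlift_tlift _ _ fb).
by apply: eq_tlift => x y; rewrite (tlift_tens fb).
Qed.

Lemma ev_takeuchi a u :
  tlift (fun x y => f (x * t a) y) (Delta u) =
  tlift (fun x y => f x (y * s a)) (Delta u).
Proof.
have := congr1 (tlift f) (lcoprod_takeuchi L u a).
rewrite !(tlift_tlift _ _ fb) => h.
transitivity (tlift (fun x y => tlift f ((x * t a) ⊗ y : UU)) (Delta u)).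
  by apply: eq_tlift => x y; rewrite (tlift_tens fb).
by rewrite h; apply: eq_tlift => x y; rewrite (tlift_tens fb).
Qed.

Lemma ev_M u v :
  tlift f (Delta (u * v)) =
  tlift (fun v1 v2 => tlift (fun u1 u2 => f (u1 * v1) (u2 * v2)) (Delta u))
        (Delta v).
Proof.
rewrite lcoprodM (tlift_tlift _ _ fb); apply: eq_tlift => v1 v2.
rewrite (tlift_tlift _ _ fb); apply: eq_tlift => u1 u2.
by rewrite (tlift_tens fb).
Qed.
End Eval.

Lemma ev_coassoc (Z : zmodType) (f : U -> U -> U -> Z) u :
    (forall x, balanced (tri_r t) (tri_l s) (f x)) ->
    (forall x x' y z, f (x + x') y z = f x y z + f x' y z) ->
    (forall a x y z, f (t a * x) y z = f x (s a * y) z) ->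
  tlift (fun x y => tlift (fun x1 x2 => f x1 x2 y) (Delta x)) (Delta u) =
  tlift (fun x y => tlift (fun y1 y2 => f x y1 y2) (Delta y)) (Delta u).
Proof.
move=> fb fD fA.
have Fb : balanced (tri_r t) (tensl (tri_l s)) (fun x (T : UU) => tlift (f x) T).
  split=> [x x' T|x T T'|x a T].
  - by rewrite -tlift_split; apply: eq_tlift => y z.
  - by rewrite (tliftD (fb x)).
  - rewrite /tensl (tlift_tlift _ _ (fb x)); apply: eq_tlift => y z.
    by rewrite (tlift_tens (fb x)) /tri_r fA.
have := congr1 (tlift (fun x T => tlift (f x) T)) (lcoassoc L u).
rewrite !(tlift_tlift _ _ Fb) => h.
transitivity (tlift (fun x y => tlift (fun x (T : UU) => tlift (f x) T)
   (tlift (fun x1 x2 => x1 ⊗ (x2 ⊗ y)) (Delta x)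
     : tensor (tri_r t) (tensl (tri_l s)))) (Delta u)).
  apply: eq_tlift => x y; rewrite (tlift_tlift _ _ Fb).
  by apply: eq_tlift => x1 x2; rewrite (tlift_tens Fb) (tlift_tens (fb x1)).
by rewrite h; apply: eq_tlift => x y; rewrite (tlift_tens Fb).
Qed.
End Theory.


Record dual (k : comPzRingType) (A U : algType k) (L : left_bialgebroid A U) :=
  Dual { dual_fun :> src_mod L -> A; dual_scalar : scalar dual_fun }.

Section Dual.
Variables (k : comPzRingType) (A U : algType k) (L : left_bialgebroid A U).
Local Notation s := (lsrc L).
Local Notation t := (ltgt L).
Local Notation Delta := (lcoprod L).
Local Notation eps := (lcounit L).
Local Notation V := (dual L).
Implicit Types (psi phi chi : V) (u v : U) (a b : A).

HB.instance Definition _ psi := GRing.isLinear.Build A (src_mod L) A *%R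
  (dual_fun psi) (dual_scalar psi).

Lemma dualP psi phi : (forall u, psi u = phi u) -> psi = phi.
Proof.
case: psi phi => [f fl] [g gl] /= /funext fg.
by case: _ / fg gl => gl; congr Dual; apply: Prop_irrelevance.
Qed.

Lemma dualD psi u v : psi (u + v) = psi u + psi v.
Proof. exact: (raddfD psi). Qed.
Lemma dual_sum psi I (r : seq I) (F : I -> U) :
  psi (\sum_(i <- r) F i) = \sum_(i <- r) psi (F i).
Proof. exact: (raddf_sum psi). Qed.
Lemma dual_src psi a u : psi (s a * u) = a * psi u.
Proof. exact: (linearZ_LR psi a u). Qed.

Definition mkdual_subproof (f : U -> A) (fD : {morph f : u v / u + v})
  (fs : forall a u, f (s a * u) = a * f u) : scalar (f : src_mod L -> A).
Proof. by move=> a u v; rewrite -fs; apply: fD. Qed.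
Definition mkdual f fD fs : V := Dual (@mkdual_subproof f fD fs).

HB.instance Definition _ := gen_eqMixin V.
HB.instance Definition _ := gen_choiceMixin V.

Lemma dual_zeroD : {morph (fun _ : U => 0 : A) : u v / u + v}.
Proof. by move=> u v; rewrite addr0. Qed.
Lemma dual_zeros a u : 0 = a * 0 :> A.
Proof. by rewrite mulr0. Qed.
Definition dual_zero : V := mkdual dual_zeroD dual_zeros.

Definition dual_add_subproof psi phi :
  scalar (fun u : src_mod L => psi u + phi u).
Proof. by move=> a u v; rewrite !linearP mulrDr addrACA. Qed.
Definition dual_add psi phi : V := Dual (dual_add_subproof psi phi).

Definition dual_opp_subproof psi : scalar (fun u : src_mod L => - psi u).
Proof. by move=> a u v; rewrite linearP opprD mulrN. Qed.
Definition dual_opp psi : V := Dual (dual_opp_subproof psi).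

Lemma dual_addA : associative dual_add.
Proof. by move=> f g h; apply: dualP => u; apply: addrA. Qed.
Lemma dual_addC : commutative dual_add.
Proof. by move=> f g; apply: dualP => u; apply: addrC. Qed.
Lemma dual_add0 : left_id dual_zero dual_add.
Proof. by move=> f; apply: dualP => u; apply: add0r. Qed.
Lemma dual_addN : left_inverse dual_zero dual_opp dual_add.
Proof. by move=> f; apply: dualP => u; apply: addNr. Qed.
HB.instance Definition _ :=
  GRing.isZmodule.Build V dual_addA dual_addC dual_add0 dual_addN.

Definition dual_scale_subproof (c : k) psi :
  scalar (fun u : src_mod L => c *: psi u).
Proof. by move=> a u v; rewrite linearP scalerDr scalerAr. Qed.
Definition dual_scale (c : k) psi : V := Dual (dual_scale_subproof c psi).

Lemma dual_scaleA c d psi :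
  dual_scale c (dual_scale d psi) = dual_scale (c * d) psi.
Proof. by apply: dualP => u; apply: scalerA. Qed.
Lemma dual_scale1 : left_id 1 dual_scale.
Proof. by move=> f; apply: dualP => u; apply: scale1r. Qed.
Lemma dual_scaleDr : right_distributive dual_scale +%R.
Proof. by move=> c f g; apply: dualP => u; apply: scalerDr. Qed.
Lemma dual_scaleDl f : {morph dual_scale^~ f : c d / c + d}.
Proof. by move=> c d; apply: dualP => u; apply: scalerDl. Qed.
HB.instance Definition _ := GRing.Zmodule_isLmodule.Build k V
  dual_scaleA dual_scale1 dual_scaleDr dual_scaleDl.

Lemma dualDl psi phi u : (psi + phi) u = psi u + phi u. Proof. by []. Qed.
Lemma dual0l u : (0 : V) u = 0. Proof. by []. Qed.
Lemma dualNl psi u : (- psi) u = - psi u. Proof. by []. Qed.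
Lemma dualZl c psi u : (c *: psi) u = c *: psi u. Proof. by []. Qed.
Lemma dual_suml I (r : seq I) (F : I -> V) u :
  (\sum_(i <- r) F i) u = \sum_(i <- r) F i u.
Proof. by elim/big_rec2: _ => [|i x y _ <-]. Qed.

Definition dual_mul_fun psi phi (u : U) : A :=
  tlift (fun u1 u2 => phi (t (psi u2) * u1)) (Delta u).

Lemma dual_mul_bal psi phi :
  balanced (tri_r t) (tri_l s) (fun u1 u2 => phi (t (psi u2) * u1)).
Proof.
split=> [x y z|x y z|x a y]; first by rewrite mulrDr dualD.
- by rewrite dualD raddfD mulrDl dualD.
- by rewrite /tri_l /tri_r dual_src ltgtM mulrA.
Qed.


Lemma dual_mul_D psi phi : {morph dual_mul_fun psi phi : u v / u + v}.
Proof. by move=> u v; rewrite /dual_mul_fun raddfD (tliftD (dual_mul_bal _ _)). Qed.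

Lemma dual_mul_s psi phi a u :
  dual_mul_fun psi phi (s a * u) = a * dual_mul_fun psi phi u.
Proof.
rewrite /dual_mul_fun (ev_src (dual_mul_bal _ _)) (morph_tlift _ _ (mulrDr a)).
by apply: eq_tlift => x y; rewrite -dual_src !mulrA lsrc_tgt.
Qed.

Definition dual_mul psi phi : V := mkdual (dual_mul_D psi phi) (dual_mul_s psi phi).

Definition dual_one : V := mkdual (raddfD eps) (lcounit_src L).

Lemma dual_mulE psi phi u :
  dual_mul psi phi u = tlift (fun u1 u2 => phi (t (psi u2) * u1)) (Delta u).
Proof. by []. Qed.

Lemma dual_mulA : associative dual_mul.
Proof.
move=> psi phi chi; apply: dualP => u; rewrite !dual_mulE.
transitivity (tlift (fun x y => tlift (fun x1 x2 =>
    chi (t (phi (t (psi y) * x2)) * x1)) (Delta x)) (Delta u)).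
  apply: eq_tlift => x y; rewrite dual_mulE.
  by rewrite (ev_tgt (dual_mul_bal _ _)).
rewrite (ev_coassoc (f := fun x y z => chi (t (phi (t (psi z) * y)) * x))).
- apply: eq_tlift => x y; rewrite dual_mulE.
  rewrite (morph_tlift (F := fun a => chi (t a * x))) // => a b.
  by rewrite raddfD mulrDl dualD.
- move=> x; split=> [y y' z|y z z'|y a z].
  + by rewrite mulrDr dualD raddfD mulrDl dualD.
  + by rewrite !(dualD, raddfD, mulrDl).
  + by rewrite /tri_r /tri_l dual_src ltgtM mulrA.
- by move=> x x' y z; rewrite mulrDr dualD.
- move=> a x y z; congr (chi _).
  by rewrite mulrA -ltgtM -dual_src !mulrA lsrc_tgt.
Qed.

Lemma dual_mul1 : left_id dual_one dual_mul.
Proof.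
move=> psi; apply: dualP => u; rewrite dual_mulE -[in RHS](lcounitr L u).
by rewrite (morph_tlift _ _ (dualD psi)).
Qed.

Lemma dual_mulr1 : right_id dual_one dual_mul.
Proof.
move=> psi; apply: dualP => u; rewrite dual_mulE -[in RHS](lcounitl L u).
rewrite (morph_tlift _ _ (dualD psi)); apply: eq_tlift => x y.
by rewrite dual_src [LHS](lcounit_tgt L).
Qed.

Lemma dual_mulDl : left_distributive dual_mul +%R.
Proof.
move=> psi phi chi; apply: dualP => u; rewrite dualDl !dual_mulE -tlift_split.
by apply: eq_tlift => x y; rewrite dualDl raddfD mulrDl dualD.
Qed.

Lemma dual_mulDr : right_distributive dual_mul +%R.
Proof.
move=> psi phi chi; apply: dualP => u; rewrite dualDl !dual_mulE -tlift_split.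
by apply: eq_tlift => x y; rewrite dualDl.
Qed.

Lemma dual_1neq0 : dual_one != 0.
Proof.
apply/eqP => /(congr1 (fun psi : V => psi 1)) /eqP.
by rewrite [X in X == _](lcounit1 L) dual0l oner_eq0.
Qed.

HB.instance Definition _ := GRing.Zmodule_isNzRing.Build V
  dual_mulA dual_mul1 dual_mulr1 dual_mulDl dual_mulDr dual_1neq0.

Lemma dualM psi phi u :
  (psi * phi) u = tlift (fun u1 u2 => phi (t (psi u2) * u1)) (Delta u).
Proof. by []. Qed.

Lemma dual1 u : (1 : V) u = eps u. Proof. by []. Qed.

Lemma dualZr psi (c : k) u : psi (c *: u) = c *: psi u.
Proof.
have -> : c *: u = s (c *: 1) * u by rewrite linearZ rmorph1 -scalerAl mul1r.
by rewrite dual_src -scalerAl mul1r.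
Qed.

Lemma dual_scalerAl (c : k) psi phi : c *: (psi * phi) = (c *: psi) * phi.
Proof.
apply: dualP => u; rewrite dualZl !dualM (morph_tlift _ _ (scalerDr c)).
by apply: eq_tlift => x y; rewrite dualZl linearZ -scalerAl dualZr.
Qed.
HB.instance Definition _ := GRing.Lmodule_isLalgebra.Build k V dual_scalerAl.

Lemma dual_scalerAr (c : k) psi phi : c *: (psi * phi) = psi * (c *: phi).
Proof. by apply: dualP => u; rewrite dualZl !dualM (morph_tlift _ _ (scalerDr c)). Qed.
HB.instance Definition _ := GRing.Lalgebra_isAlgebra.Build k V dual_scalerAr.

Definition dual_s_subproof a : scalar (fun u : src_mod L => eps u * a).
Proof.
move=> b u v; rewrite raddfD mulrDl; congr (_ + _).
by rewrite [eps (b *: u)](lcounit_src L) mulrA.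
Qed.
Definition dual_s a : V := Dual (dual_s_subproof a).

Definition dual_t_subproof a : scalar (fun u : src_mod L => eps ((u : U) * t a)).
Proof.
move=> b u v; rewrite mulrDl raddfD; congr (_ + _).
by rewrite -mulrA [LHS](lcounit_src L).
Qed.
Definition dual_t a : V := Dual (dual_t_subproof a).

Lemma dual_sE a u : dual_s a u = eps u * a. Proof. by []. Qed.
Lemma dual_tE a u : dual_t a u = eps (u * t a). Proof. by []. Qed.

Lemma bal_eval psi : balanced (tri_r t) (tri_l s) (fun x y => eps x * psi y).
Proof.
split=> [x x' y|x y y'|x a y]; rewrite ?raddfD ?dualD ?mulrDl ?mulrDr //.
by rewrite /tri_l /tri_r dual_src lcounit_tgt mulrA.
Qed.

Lemma eval_counitl psi u : tlift (fun x y => eps x * psi y) (Delta u) = psi u.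
Proof.
rewrite -[in RHS](lcounitl L u) (morph_tlift _ _ (dualD psi)).
by apply: eq_tlift => x y; rewrite dual_src.
Qed.

Lemma dual_mul_s_r psi a u : (psi * dual_s a) u = psi u * a.
Proof.
rewrite dualM -[in RHS]eval_counitl (morph_tlift _ _ (fun x y => mulrDl x y a)).
by apply: eq_tlift => x y; rewrite dual_sE lcounit_tgt.
Qed.

Lemma dual_mul_t_r psi a u : (psi * dual_t a) u = psi (u * s a).
Proof.
rewrite dualM -eval_counitl (ev_Msrc (bal_eval psi)).
apply: eq_tlift => x y; rewrite dual_tE -mulrA lcounit_tgt.
by rewrite lcounit_mul_tgt.
Qed.
End Dual.

Section DualBialgebroid.
Variables (k : comPzRingType) (A U : algType k) (L : left_bialgebroid A U).
Local Notation s := (lsrc L).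
Local Notation t := (ltgt L).
Local Notation Delta := (lcoprod L).
Local Notation eps := (lcounit L).
Local Notation V := (dual L).
Implicit Types (psi phi : V) (u v : U) (a b : A).

Lemma dual_mul_s_l psi a u : (dual_s L a * psi) u = psi (t a * u).
Proof.
rewrite dualM -[in RHS](lcounitr L u).
rewrite (morph_tlift (F := fun x => psi (t a * x))) => [|x y]; last first.
  by rewrite mulrDr dualD.
by apply: eq_tlift => x y; rewrite dual_sE ltgtM mulrA.
Qed.

Lemma dual_mul_t_l psi a u : (dual_t L a * psi) u = psi (u * t a).
Proof.
rewrite dualM -[in RHS](lcounitr L (u * t a)) (ev_Mtgt (f := fun x y => t (eps y) * x)).
  by rewrite (morph_tlift _ _ (dualD psi)); apply: eq_tlift.
split=> [x y z|x y z|x b y]; first by rewrite mulrDr.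
- by rewrite !raddfD mulrDl.
- by rewrite /tri_l /tri_r lcounit_src ltgtM mulrA.
Qed.

Lemma dual_s_linear : linear (dual_s L).
Proof.
move=> c a b; apply: dualP => u.
by rewrite dualDl dualZl !dual_sE mulrDr -scalerAr.
Qed.
HB.instance Definition _ := GRing.isLinear.Build k A V *:%R (dual_s L) dual_s_linear.

Lemma dual_s_morph : monoid_morphism (dual_s L).
Proof.
split=> [|a b]; apply: dualP => u; first by rewrite dual_sE mulr1.
by rewrite dual_mul_s_r !dual_sE mulrA.
Qed.
HB.instance Definition _ := GRing.isMonoidMorphism.Build A V (dual_s L) dual_s_morph.

Lemma dual_t_linear : linear (dual_t L).
Proof.
move=> c a b; apply: dualP => u; rewrite dualDl dualZl !dual_tE linearP mulrDr raddfD.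
by congr (_ + _); rewrite -scalerAr; apply: (dualZr (1 : V)).
Qed.
HB.instance Definition _ := GRing.isLinear.Build k A V *:%R (dual_t L) dual_t_linear.

Lemma dual_t_morph : monoid_morphism (dual_t L : A^c -> V).
Proof.
split=> [|a b]; apply: dualP => u; first by rewrite dual_tE ltgt1 mulr1.
rewrite dual_mul_t_r !dual_tE -[a * b]/((b : A) * (a : A)) ltgtM mulrA.
by rewrite lcounit_mul_tgt -!mulrA -lsrc_tgt.
Qed.

Lemma dual_s_t a b : dual_s L a * dual_t L b = dual_t L b * dual_s L a.
Proof.
apply: dualP => u; rewrite dual_mul_t_r dual_mul_s_r dual_sE dual_tE.
by rewrite lcounit_mul_tgt.
Qed.

Local Notation VV := (tensor (btri_r (dual_s L)) (btri_l (dual_t L))).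

Definition dual_pair (T : VV) u v : A :=
  tlift (fun psi1 psi2 => psi2 (u * s (psi1 v))) T.

Lemma bal_dual_pair u v : balanced (btri_r (dual_s L)) (btri_l (dual_t L))
  (fun psi1 psi2 => psi2 (u * s (psi1 v))).
Proof.
split=> [f g h|f g h|f a g].
- by rewrite dualDl raddfD mulrDr dualD.
- by rewrite dualDl.
- by rewrite /btri_r /btri_l dual_mul_s_r dual_mul_t_r rmorphM mulrA.
Qed.

Definition is_dual_basis n (e : 'I_n -> U) (f : 'I_n -> V) : Prop :=
  forall u, u = \sum_j s (f j u) * e j.

Section Basis.
Variables (n : nat) (e : 'I_n -> U) (f : 'I_n -> V).
Hypothesis ef : is_dual_basis e f.

Lemma dual_basisE psi : psi = \sum_j f j * dual_s L (psi (e j)).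
Proof.
apply: dualP => u; rewrite dual_suml {1}(ef u) dual_sum.
by apply: eq_bigr => j _; rewrite dual_src dual_mul_s_r.
Qed.

Lemma dual_tens_inj (N : zmodType) (nl : A -> N -> N)
    (T T' : tensor (btri_r (dual_s L)) nl) :
    (forall a b x, nl (a * b) x = nl a (nl b x)) ->
    (forall a x y, nl a (x + y) = nl a x + nl a y) ->
    (forall a b x, nl (a + b) x = nl a x + nl b x) ->
    (forall u, tlift (fun psi x => nl (psi u) x) T =
               tlift (fun psi x => nl (psi u) x) T') ->
  T = T'.
Proof.
move=> nlM nlDr nlDl h.
have E (S : tensor (btri_r (dual_s L)) nl) :
    S = \sum_j f j ⊗ tlift (fun psi x => nl (psi (e j)) x) S.
  rewrite -[LHS]tlift_repr.
  transitivity (tlift (fun psi x =>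
     \sum_j f j ⊗ nl (psi (e j)) x : tensor (btri_r (dual_s L)) nl) S).
    apply: eq_tlift => psi x; rewrite [psi in LHS]dual_basisE tens_suml.
    by apply: eq_bigr => j _; rewrite -tens_bal.
  rewrite /tlift exchange_big; apply: eq_bigr => j _.
  by rewrite [RHS]tens_sumr.
by rewrite (E T) (E T'); apply: eq_bigr => j _; rewrite h.
Qed.

Lemma dual_pair_inj (T T' : VV) :
  (forall u v, dual_pair T u v = dual_pair T' u v) -> T = T'.
Proof.
move=> h; apply: dual_tens_inj => [a b x|a x y|a b x|v].
- by apply: dualP => u; rewrite /btri_l !dual_mul_t_r rmorphM mulrA.
- by rewrite /btri_l mulrDl.
- by rewrite /btri_l raddfD mulrDr.
have E (S : VV) u : tlift (fun psi x => btri_l (dual_t L) (psi v) x) S u =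
    dual_pair S u v.
  rewrite (morph_tlift (F := fun x : V => x u)) //.
  by apply: eq_tlift => x y; rewrite dual_mul_t_r.
by apply: dualP => u; rewrite !E.
Qed.

Lemma dual_coprod_basis psi : exists T : VV,
  forall u v, psi (u * v) = dual_pair T u v.
Proof.
have D j : scalar (fun u : src_mod L => psi ((u : U) * e j)).
  move=> a u v; rewrite mulrDl dualD; congr (_ + _).
  by rewrite -mulrA dual_src.
exists (\sum_j f j ⊗ Dual (D j)) => u v.
rewrite /dual_pair (tlift_sum (bal_dual_pair _ _)) {1}(ef v) mulr_sumr dual_sum.
by apply: eq_bigr => j _; rewrite (tlift_tens (bal_dual_pair _ _)) /= mulrA.
Qed.
End Basis.

Lemma dual_basis_exists : is_fgp (src_mod L) ->
  exists n (e : 'I_n -> U) (f : 'I_n -> V), is_dual_basis e f.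
Proof.
case=> n [i [p ip]].
have D j : scalar (fun x : src_mod L => i x 0 j)
  by move=> a x y; rewrite linearP !mxE.
exists n, (fun j => p (delta_mx 0 j)), (fun j => Dual (D j)) => u.
rewrite -[LHS](ip u) [i u in LHS]row_sum_delta linear_sum.
by apply: eq_bigr => j _; rewrite linearZ.
Qed.

Section Fgp.
Hypothesis U_fgp : is_fgp (src_mod L).

Lemma dual_coprod_exists psi : exists T : VV,
  forall u v, psi (u * v) = dual_pair T u v.
Proof.
by have [n [e [f ef]]] := dual_basis_exists U_fgp; apply: dual_coprod_basis ef psi.
Qed.

(* The coproduct of psi is the unique tensor T with
   psi(u v) = dual_pair T u v (uniqueness is dual_pair_inj). *)
Definition dual_coprod psi : VV := projT1 (cid (dual_coprod_exists psi)).

Lemma dual_coprodE psi u v :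
  tlift (fun psi1 psi2 => psi2 (u * s (psi1 v))) (dual_coprod psi) = psi (u * v).
Proof. by rewrite (projT2 (cid (dual_coprod_exists psi))). Qed.

Lemma dual_tensP (T T' : VV) :
  (forall u v, dual_pair T u v = dual_pair T' u v) -> T = T'.
Proof.
by have [n [e [f ef]]] := dual_basis_exists U_fgp; apply: dual_pair_inj ef _ _.
Qed.

Lemma dual_coprodD : {morph dual_coprod : psi phi / psi + phi}.
Proof.
move=> psi phi; apply: dual_tensP => u v.
by rewrite [RHS](tliftD (bal_dual_pair _ _)) /dual_pair !dual_coprodE.
Qed.

Lemma dual_coprodB : zmod_morphism dual_coprod.
Proof.
move=> psi phi; apply: (addIr (dual_coprod phi)).
by rewrite -dual_coprodD !subrK.
Qed.
HB.instance Definition _ :=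
  GRing.isZmodMorphism.Build V VV dual_coprod dual_coprodB.

Lemma dual_pair_tlift (A' : Type) (M N : zmodType) (mr : M -> A' -> M)
    (nl : A' -> N -> N) (g : M -> N -> VV) (T : tensor mr nl) u v :
  dual_pair (tlift g T) u v = tlift (fun m n => dual_pair (g m n) u v) T.
Proof. exact: tlift_tlift (bal_dual_pair u v). Qed.

Lemma dual_pair_tens psi phi u v :
  dual_pair (psi ⊗ phi) u v = phi (u * s (psi v)).
Proof. exact: tlift_tens (bal_dual_pair u v) _ _. Qed.

Lemma dual_pair_coprod psi u v : dual_pair (dual_coprod psi) u v = psi (u * v).
Proof. exact: dual_coprodE. Qed.

Definition dual_counit psi : A := psi 1.
Lemma dual_counitB : zmod_morphism dual_counit. Proof. by []. Qed.
HB.instance Definition _ :=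
  GRing.isZmodMorphism.Build V A dual_counit dual_counitB.

Lemma dual_coprod_bimod a b psi :
  dual_coprod (psi * dual_t L a * dual_s L b) =
  tlift (fun x y => (x * dual_t L a) ⊗ (y * dual_s L b)) (dual_coprod psi).
Proof.
apply: dual_tensP => u v; rewrite dual_pair_tlift dual_pair_coprod.
rewrite dual_mul_s_r dual_mul_t_r -mulrA -dual_coprodE.
rewrite (morph_tlift (F := fun x => x * b)) => [|x y]; last exact: mulrDl.
by apply: eq_tlift => x y; rewrite dual_pair_tens dual_mul_s_r dual_mul_t_r.
Qed.

Lemma dual_counit_bimod a b psi :
  dual_counit (psi * dual_t L a * dual_s L b) = a * dual_counit psi * b.
Proof.
by rewrite /dual_counit dual_mul_s_r dual_mul_t_r mul1r -[s a]mulr1 dual_src.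
Qed.

Lemma dual_coassoc psi :
  tlift (fun x y => tlift (fun x1 x2 => x1 ⊗ (x2 ⊗ y)) (dual_coprod x))
        (dual_coprod psi) =
  tlift (fun x y => x ⊗ dual_coprod y) (dual_coprod psi)
    :> tensor (btri_r (dual_s L)) (tensl (btri_l (dual_t L))).
Proof.
set nl : A -> VV -> VV := tensl (btri_l (dual_t L)).
have nl_pair a T u v : dual_pair (nl a T) u v = dual_pair T u (v * s a).
  rewrite dual_pair_tlift; apply: eq_tlift => x y.
  by rewrite dual_pair_tens /btri_l dual_mul_t_r.
have pairD T T' u v : dual_pair (T + T') u v = dual_pair T u v + dual_pair T' u v.
  exact: tliftD (bal_dual_pair u v) _ _.
have nlM a b T : nl (a * b) T = nl a (nl b T).
  by apply: dual_tensP => u v; rewrite !nl_pair rmorphM mulrA.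
have nlDr a T T' : nl a (T + T') = nl a T + nl a T'.
  by apply: dual_tensP => u v; rewrite pairD !nl_pair pairD.
have nlDl a b T : nl (a + b) T = nl a T + nl b T.
  apply: dual_tensP => u v; rewrite pairD !nl_pair raddfD mulrDr.
  rewrite -tlift_split; apply: eq_tlift => x y.
  by rewrite dualD raddfD mulrDr dualD.
have [n [e [f ef]]] := dual_basis_exists U_fgp.
apply: (dual_tens_inj ef nlM nlDr nlDl) => w.
have b3 : balanced (btri_r (dual_s L)) nl (fun x T => nl (x w) T).
  split=> [x x' T|x T T'|x a T] //; first exact: nlDl.
  by rewrite /btri_r dual_mul_s_r nlM.
rewrite !(tlift_tlift _ _ b3); apply: dual_tensP => u v.
rewrite !dual_pair_tlift.
transitivity (psi (u * (v * w))).
  rewrite -dual_coprodE; apply: eq_tlift => x y.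
  rewrite (tlift_tlift _ _ b3) dual_pair_tlift -(dual_coprodE x).
  rewrite (morph_tlift (F := fun a => y (u * s a))) => [|a b]; last first.
    by rewrite raddfD mulrDr dualD.
  apply: eq_tlift => x1 x2.
  by rewrite (tlift_tens b3) nl_pair dual_pair_tens.
rewrite mulrA -dual_coprodE; apply: eq_tlift => x y.
by rewrite (tlift_tens b3) nl_pair dual_pair_coprod mulrA.
Qed.

Lemma dual_counitl psi :
  tlift (fun x y => y * dual_t L (dual_counit x)) (dual_coprod psi) = psi.
Proof.
apply: dualP => u; rewrite (morph_tlift (F := fun x : V => x u)) //.
rewrite -[u in RHS]mulr1 -dual_coprodE; apply: eq_tlift => x y.
by rewrite dual_mul_t_r.
Qed.

Lemma dual_counitr psi :
  tlift (fun x y => x * dual_s L (dual_counit y)) (dual_coprod psi) = psi.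
Proof.
apply: dualP => u; rewrite (morph_tlift (F := fun x : V => x u)) //.
rewrite -[u in RHS]mul1r -dual_coprodE; apply: eq_tlift => x y.
by rewrite dual_mul_s_r mul1r -[s _]mulr1 dual_src.
Qed.

Lemma dual_takeuchi psi b :
  tlift (fun x y => (dual_s L b * x) ⊗ y) (dual_coprod psi) =
  tlift (fun x y => x ⊗ (dual_t L b * y)) (dual_coprod psi) :> VV.
Proof.
apply: dual_tensP => u v; rewrite !dual_pair_tlift.
transitivity (psi (u * (t b * v))).
  by rewrite -dual_coprodE; apply: eq_tlift => x y; rewrite dual_pair_tens dual_mul_s_l.
rewrite mulrA -dual_coprodE; apply: eq_tlift => x y.
by rewrite dual_pair_tens dual_mul_t_l -!mulrA lsrc_tgt.
Qed.

Lemma dual_coprod1 : dual_coprod 1 = 1 ⊗ 1.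
Proof.
apply: dual_tensP => u v; rewrite dual_pair_coprod dual_pair_tens !dual1.
exact: lcounitM_src.
Qed.

Lemma dual_coprodM psi phi :
  dual_coprod (psi * phi) =
  tlift (fun psi1 psi2 => tlift (fun phi1 phi2 => (psi1 * phi1) ⊗ (psi2 * phi2))
    (dual_coprod phi)) (dual_coprod psi).
Proof.
apply: dual_tensP => u v; rewrite dual_pair_coprod dual_pair_tlift dualM.
have b1 := dual_mul_bal psi phi.
rewrite (ev_M b1).
transitivity (tlift (fun psi1 psi2 => tlift (fun v1 v2 => tlift (fun u1 u2 =>
    phi (t (psi2 u2) * u1 * t (psi1 v2) * v1)) (Delta u)) (Delta v))
    (dual_coprod psi)).
  rewrite [RHS]tlift_exchange; apply: eq_tlift => v1 v2.
  have b2 psi1 psi2 : balanced (tri_r t) (tri_l s)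
      (fun u1 u2 => phi (t (psi2 u2) * u1 * v1)).
    split=> [x y z|x y z|x a y].
    - by rewrite mulrDr mulrDl dualD.
    - by rewrite dualD raddfD !mulrDl dualD.
    - by rewrite /tri_l /tri_r dual_src ltgtM !mulrA.
  transitivity (tlift (fun psi1 psi2 => tlift (fun u1 u2 =>
      phi (t (psi2 (u2 * s (psi1 v2))) * u1 * v1)) (Delta u)) (dual_coprod psi)).
    rewrite [RHS]tlift_exchange; apply: eq_tlift => u1 u2.
    rewrite -(dual_coprodE psi) (morph_tlift (F := fun a => phi (t a * (u1 * v1)))).
      by apply: eq_tlift => x y; rewrite mulrA.
    by move=> a b; rewrite raddfD mulrDl dualD.
  apply: eq_tlift => psi1 psi2; rewrite -(ev_takeuchi (b2 psi1 psi2)).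
  by apply: eq_tlift => u1 u2; rewrite !mulrA.
apply: eq_tlift => psi1 psi2; rewrite dual_pair_tlift.
transitivity (tlift (fun phi1 phi2 => tlift (fun u1 u2 => tlift (fun v1 v2 =>
    phi2 (t (psi2 u2) * u1 * s (phi1 (t (psi1 v2) * v1)))) (Delta v)) (Delta u))
    (dual_coprod phi)).
  rewrite [LHS]tlift_exchange [RHS]tlift_exchange; apply: eq_tlift => u1 u2.
  rewrite [RHS]tlift_exchange; apply: eq_tlift => v1 v2.
  by rewrite -mulrA -(dual_coprodE phi).
apply: eq_tlift => phi1 phi2; rewrite dual_pair_tens dualM.
rewrite (ev_Msrc (dual_mul_bal psi2 phi2)); apply: eq_tlift => u1 u2.
rewrite dualM (morph_tlift (F := fun a => phi2 (t (psi2 u2) * (u1 * s a)))).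
  by apply: eq_tlift => v1 v2; rewrite mulrA.
by move=> a b; rewrite raddfD !mulrDr dualD.
Qed.

Lemma dual_counitM_src psi phi :
  dual_counit (psi * phi) = dual_counit (dual_s L (dual_counit psi) * phi).
Proof.
rewrite /dual_counit dual_mul_s_l dualM lcoprod1.
by rewrite (tlift_tens (dual_mul_bal _ _)).
Qed.

Lemma dual_counitM_tgt psi phi :
  dual_counit (psi * phi) = dual_counit (dual_t L (dual_counit psi) * phi).
Proof.
rewrite dual_counitM_src /dual_counit dual_mul_s_l dual_mul_t_l.
by rewrite mulr1 mul1r.
Qed.

Definition dual_bialgebroid : right_bialgebroid A V :=
  @RightBialgebroid k A V (dual_s L) (dual_t L) dual_t_morph dual_s_t
    dual_coprod dual_counit dual_coprod_bimod dual_counit_bimod dual_coassoc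
    dual_counitl dual_counitr dual_takeuchi dual_coprod1 dual_coprodM
    (lcounit1 L) dual_counitM_src dual_counitM_tgt.

End Fgp.
End DualBialgebroid.

Section Induced.
Variables (k : comPzRingType) (A U : algType k) (L : left_bialgebroid A U).
Variables (U_fgp : is_fgp (src_mod L)).
Variables (n : nat) (e : 'I_n -> U) (f : 'I_n -> dual L).
Local Notation s := (lsrc L).
Local Notation Ud := (dual_bialgebroid U_fgp).

(* r psi = r_[0] psi(r_[1]) and r^(-1) ⊗ r^(0) = \sum_j e^j ⊗ e_j r *)
Definition lr_to_rl (M : lmodType k) (D : lr_data L M) : rl_data Ud M :=
  @RLData k A (dual L) Ud M
    (fun r psi => tlift (fun r0 r1 => lr_ract D r0 (psi r1)) (lr_coact D r))
    (fun a r => lr_act D (s a) r)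
    (fun r => \sum_j f j ⊗ lr_act D (e j) r).

(* u r = r^(-1)(u) r^(0) and r_[0] ⊗ r_[1] = \sum_j r e^j ⊗ e_j *)
Definition rl_to_lr (M : lmodType k) (D : rl_data Ud M) : lr_data L M :=
  @LRData k A U L M
    (fun u r => tlift (fun (r1 : dual L) r0 => rl_lact D (r1 u) r0) (rl_coact D r))
    (fun r a => rl_act D r (rsrc Ud a))
    (fun r => \sum_j rl_act D r (f j) ⊗ e j).

End Induced.

(* Main.v *)
Require Import Defs.
From HB Require Import structures.
From mathcomp Require Import all_boot all_algebra.

Set Implicit Arguments.
Unset Strict Implicit.
Unset Printing Implicit Defensive.

Import GRing.Theory.
Local Open Scope ring_scope.

(** A left U-action and a right U_*-action on the same object carry all the data
   on both sides: since U is finitely generated projective over A, each coaction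
   is recovered from the action of the dual, and an identity between tensors in
   M ⊗_A U (resp. U_* ⊗_A M) may be tested by evaluating at every psi in U_*
   (resp. u in U).  Evaluated in this way, the axioms of a braided commutative
   monoid in the left-right and in the right-left category turn into the same
   list of axioms on the two actions. *)

(** The correspondence crosses over. Evaluating psi on a product in U splits psi, by psi(x y) =
    psi2(x s(psi1(y))); evaluating a product in U_* at u splits u by Delta. So a law on either
    coaction becomes a law on the action of the dual: multiplicativity of one is the module-algebra
    law of the other. In the Yetter-Drinfeld condition the two sides are exchanged: the left-hand
    side over U and the right-hand side over U_* have the same evaluation. The difficulty is the
    noncommutative base: a value such as psi1(y) in A lands inside a product in U or in R and has to
    be carried to a module element, by the Takeuchi property of Delta or by the balance of the
    product of R. Hence the laws of a pair record how the sources and targets of both bialgebroids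
    act. *)

Section TensorComplements.
Variables (A : Type) (M N : zmodType) (mr : M -> A -> M) (nl : A -> N -> N).

Lemma tlift_bigsum (Z : zmodType) I (r : seq I) (F : I -> M -> N -> Z)
    (T : tensor mr nl) :
  tlift (fun m x => \sum_(i <- r) F i m x) T = \sum_(i <- r) tlift (F i) T.
Proof. exact: exchange_big. Qed.

Lemma tlift_sum_tens (Z : zmodType) (f : M -> N -> Z) I (r : seq I)
    (F : I -> M) (G : I -> N) : balanced mr nl f ->
  tlift f (\sum_(i <- r) F i ⊗ G i : tensor mr nl) = \sum_(i <- r) f (F i) (G i).
Proof.
move=> fb; rewrite (tlift_sum fb); apply: eq_bigr => i _.
exact: tlift_tens fb _ _.
Qed.

Lemma balanced_comp (Z Z' : zmodType) (F : Z -> Z') (f : M -> N -> Z) :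
  {morph F : x y / x + y} -> balanced mr nl f ->
  balanced mr nl (fun m x => F (f m x)).
Proof. by move=> FD [fDl fDr fA]; split=> *; rewrite ?fDl ?fDr ?fA ?FD. Qed.

(** A dual basis of N expands T as the sum of the (id ⊗ h_i)(T) ⊗ g_i, so these coordinates
    determine T. The index type is arbitrary because N will be U, and also U ⊗_A U with pairs of
    indices. *)
Lemma tens_inj_basis (I : finType) (g : I -> N) (h : I -> N -> A)
    (T T' : tensor mr nl) :
    (forall x, x = \sum_i nl (h i x) (g i)) ->
    (forall i, tlift (fun m x => mr m (h i x)) T =
               tlift (fun m x => mr m (h i x)) T') ->
  T = T'.
Proof.
move=> gh hT.
have E (S : tensor mr nl) :
    S = \sum_i tlift (fun m x => mr m (h i x)) S ⊗ g i.
  rewrite -[LHS]tlift_repr.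
  transitivity (tlift (fun m x =>
     \sum_i mr m (h i x) ⊗ g i : tensor mr nl) S).
    apply: eq_tlift => m x; rewrite [x in LHS]gh tens_sumr.
    by apply: eq_bigr => i _; rewrite tens_bal.
  rewrite tlift_bigsum; apply: eq_bigr => i _.
  by rewrite [RHS]tens_suml.
by rewrite (E T) (E T'); apply: eq_bigr => i _; rewrite hT.
Qed.

End TensorComplements.

Section Modules.
Variables (k : comPzRingType) (A : algType k) (M : lmodType k).

Section Left.
Variables (act : A -> M -> M) (actP : is_left_module act).

Lemma lact_suml I (r : seq I) (F : I -> A) m :
  act (\sum_(i <- r) F i) m = \sum_(i <- r) act (F i) m.
Proof.
apply: (big_morph (act^~ m)) => [x y|]; first exact: lmodADl.
by apply: (addrI (act 0 m)); rewrite -(lmodADl actP) !addr0.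
Qed.
End Left.

Section Right.
Variables (act : M -> A -> M) (actP : is_right_module act).

Lemma ract_sumr I (r : seq I) (F : I -> A) m :
  act m (\sum_(i <- r) F i) = \sum_(i <- r) act m (F i).
Proof.
apply: (big_morph (act m)) => [x y|]; first exact: rmodADr.
by apply: (addrI (act m 0)); rewrite -(rmodADr actP) !addr0.
Qed.
End Right.
End Modules.

(** * Pairs of actions of U and U_* *)

Section Pair.
Variables (k : comPzRingType) (A U : algType k) (L : left_bialgebroid A U).
Variable U_fgp : is_fgp (src_mod L).
Local Notation s := (lsrc L).
Local Notation t := (ltgt L).
Local Notation Delta := (lcoprod L).
Local Notation eps := (lcounit L).
Local Notation V := (dual L).
Local Notation ds := (dual_s L).
Local Notation dt := (dual_t L).
Local Notation dDelta := (dual_coprod U_fgp).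

Lemma dual_shiftD (psi : V) (u : U) :
  {morph (fun x : U => psi (x * u)) : x y / x + y}.
Proof. by move=> x y; rewrite mulrDl dualD. Qed.
Lemma dual_shift_src (psi : V) (u : U) a x : psi (s a * x * u) = a * psi (x * u).
Proof. by rewrite -mulrA dual_src. Qed.
(** The left U-action on U_* transposed to right multiplication in U. It absorbs the factor u_(1)
    that the Yetter-Drinfeld condition puts to the right of the coaction of u_(2) m. *)
Definition dual_shift (psi : V) (u : U) : V :=
  mkdual (dual_shiftD psi u) (dual_shift_src psi u).

Lemma dual_shiftE psi u x : dual_shift psi u x = psi (x * u). Proof. by []. Qed.

(** The coproduct governs psi(x u), and right multiplication by [dt a] in U_* is precomposition with
    right multiplication by [s a]. This is the form in which the shift arises when the right-left
    condition is evaluated. *)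
Lemma dual_shift_coprod psi u :
  tlift (fun psi1 psi2 : V => psi2 * dt (psi1 u)) (dDelta psi) = dual_shift psi u.
Proof.
apply: dualP => x; rewrite (morph_tlift (F := fun p : V => p x)) //.
rewrite dual_shiftE -(dual_coprodE U_fgp psi x u).
by apply: eq_tlift => p q; rewrite dual_mul_t_r.
Qed.

(* A left-right Yetter-Drinfeld module over U, and equally a right-left one over
   U_*, amounts to a left U-action and a right U_*-action on the same module;
   both Yetter-Drinfeld conditions become the following pair_YD once the
   coactions are evaluated, on psi in U_* and on u in U respectively. *)
Record is_YD_pair (M : lmodType k) (lact : U -> M -> M) (ract : M -> V -> M) :
    Prop := IsYDPair {
  pair_left : is_left_module lact;
  pair_right : is_right_module ract;
  pair_src : forall a m, ract m (dt a) = lact (s a) m;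
  pair_tgt : forall a m, lact (t a) m = ract m (ds a);
  pair_YD : forall u psi m,
    tlift (fun u1 u2 => ract (lact u2 m) (dual_shift psi u1)) (Delta u) =
    tlift (fun u1 u2 => tlift (fun psi1 psi2 : V =>
        ract (lact u1 (ract m psi1)) (ds (psi2 u2))) (dDelta psi)) (Delta u) }.

(** Each multiplicativity or unit law is an action law on one side and a coaction law on the other:
    [mpair_ractM] encodes the coaction of U on products, [mpair_lactM] that of U_*. *)
Record is_monoid_pair (R : algType k) (lact : U -> R -> R) (ract : R -> V -> R) :
    Prop := IsMonoidPair {
  mpair_YD : is_YD_pair lact ract;
  mpair_lactM : forall u r r',
    lact u (r * r') = tlift (fun u1 u2 => lact u1 r * lact u2 r') (Delta u);
  mpair_ractM : forall psi r r',
    ract (r * r') psi =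
    tlift (fun psi1 psi2 : V => ract r psi1 * ract r' psi2) (dDelta psi);
  mpair_lact1 : forall u, lact u 1 = lact (s (eps u)) 1;
  mpair_ract1 : forall psi, ract 1 psi = ract 1 (ds (psi 1));
  mpair_bilinl : forall a r r', lact (s a) (r * r') = lact (s a) r * r';
  mpair_bilinr : forall a r r', ract (r * r') (ds a) = r * ract r' (ds a);
  mpair_balance : forall a r r', ract r (ds a) * r' = r * lact (s a) r' }.

(** The common form of r'_[0] (r'_[1] r), with r'_[1] expanded along the e_j, and of (r' r^(-1))
    r^(0), with r^(-1) expanded along the f_j. *)
Definition pair_braided_commutative (R : algType k) (lact : U -> R -> R)
    (ract : R -> V -> R) n (e : 'I_n -> U) (f : 'I_n -> V) : Prop :=
  forall r r', r * r' = \sum_j ract r' (f j) * lact (e j) r.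

End Pair.

(** * From a right U-comodule to a right U_*-module *)

Section LeftRightComodule.
Variables (k : comPzRingType) (A U : algType k) (L : left_bialgebroid A U).
Local Notation s := (lsrc L).
Local Notation t := (ltgt L).
Local Notation Delta := (lcoprod L).
Local Notation V := (dual L).
Local Notation ds := (dual_s L).
Local Notation dt := (dual_t L).
Variables (M : lmodType k) (ract : M -> A -> M).
Variables (rho : M -> tensor ract (tri_l s)).
Hypothesis rhoP : is_right_comodule rho.

Let ractP := rcomod_module rhoP.

Definition coact_eval (m : M) (psi : V) : M :=
  tlift (fun m0 m1 => ract m0 (psi m1)) (rho m).

Lemma balanced_coact_eval (psi : V) :
  balanced ract (tri_l s) (fun m0 m1 => ract m0 (psi m1)).
Proof.
split=> [m m' x|m x x'|m a x]; first exact: rmodADl.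
- by rewrite dualD (rmodADr ractP).
- by rewrite -(rmodAM ractP) /tri_l dual_src.
Qed.

Lemma ractS m a (psi : V) x : ract (ract m a) (psi x) = ract m (psi (s a * x)).
Proof. exact: balA (balanced_coact_eval psi) m a x. Qed.

Section EvalCoaction.
Variables (Z : zmodType) (f : M -> U -> Z).
Hypothesis fb : balanced ract (tri_l s) f.

Lemma ev_coactD m m' : tlift f (rho (m + m')) = tlift f (rho m) + tlift f (rho m').
Proof. by rewrite (rcoactD rhoP) (tliftD fb). Qed.

Lemma ev_coact_ract a m :
  tlift f (rho (ract m a)) = tlift (fun m0 m1 => f m0 (t a * m1)) (rho m).
Proof.
rewrite (rcoact_lin rhoP) (tlift_tlift _ _ fb); apply: eq_tlift => x y.
exact: tlift_tens fb _ _.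
Qed.
End EvalCoaction.

(** Coassociativity is an identity in M ⊗_A (U ⊗_A U); the hypotheses on f make the inner and the
    outer lift balanced, so that f can be applied to both sides. *)
Lemma ev_coact_coassoc (Z : zmodType) (f : M -> U -> U -> Z) m :
    (forall x, balanced (tri_r t) (tri_l s) (f x)) ->
    (forall x x' y z, f (x + x') y z = f x y z + f x' y z) ->
    (forall a x y z, f (ract x a) y z = f x (s a * y) z) ->
  tlift (fun m0 m1 => tlift (fun n0 n1 => f n0 n1 m1) (rho m0)) (rho m) =
  tlift (fun m0 m1 => tlift (f m0) (Delta m1)) (rho m).
Proof.
move=> fb fD fA.
have Fb : balanced ract (tensl (tri_l s))
    (fun x (T : tensor (tri_r t) (tri_l s)) => tlift (f x) T).
  split=> [x x' T|x T T'|x a T].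
  - by rewrite -tlift_split; apply: eq_tlift => y z.
  - by rewrite (tliftD (fb x)).
  - rewrite /tensl (tlift_tlift _ _ (fb x)); apply: eq_tlift => y z.
    by rewrite (tlift_tens (fb x)) fA.
have := congr1 (tlift (fun x T => tlift (f x) T)) (rcoact_coassoc rhoP m).
rewrite !(tlift_tlift _ _ Fb) => h.
transitivity (tlift (fun m0 m1 =>
   tlift (fun x (T : tensor (tri_r t) (tri_l s)) => tlift (f x) T)
   (tlift (fun n0 n1 => n0 ⊗ (n1 ⊗ m1)) (rho m0)
     : tensor ract (tensl (tri_l s)))) (rho m)).
  apply: eq_tlift => x y; rewrite (tlift_tlift _ _ Fb).
  by apply: eq_tlift => x1 x2; rewrite (tlift_tens Fb) (tlift_tens (fb x1)).
by rewrite h; apply: eq_tlift => x y; rewrite (tlift_tens Fb).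
Qed.

(** By the product formula in U_*, m (psi phi) is m_[0] phi(t(psi(m_[2])) m_[1]). Since the coaction
    sends m a to m_[0] ⊗ t(a) m_[1], this is psi applied first and phi afterwards. The unit of U_*
    is [eps], so the unit law is counitality. *)
Lemma coact_eval_right_module : is_right_module (coact_eval : M -> V -> M).
Proof.
split=> [m|m psi phi|m m' psi|m psi phi|c m psi].
- exact: rcoact_counit.
- rewrite /coact_eval.
  rewrite [RHS](morph_tlift (F := fun m =>
    tlift (fun m0 m1 => ract m0 (phi m1)) (rho m))); last first.
    exact: ev_coactD (balanced_coact_eval phi).
  transitivity (tlift (fun m0 m1 => tlift (fun x y => ract m0 (phi (t (psi y) * x)))
      (Delta m1)) (rho m)).
    apply: eq_tlift => m0 m1; rewrite dualM (morph_tlift (F := ract m0)) //.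
    exact: rmodADr.
  rewrite -(ev_coact_coassoc (f := fun m0 x y => ract m0 (phi (t (psi y) * x)))).
  + apply: eq_tlift => m0 m1.
    by rewrite (ev_coact_ract (balanced_coact_eval phi)).
  + move=> x; apply: balanced_comp (dual_mul_bal psi phi).
    exact: (rmodADr ractP).
  + by move=> *; apply: rmodADl.
  + move=> a x y z; rewrite ractS !mulrA.
    by rewrite lsrc_tgt.
- exact: ev_coactD (balanced_coact_eval psi) _ _.
- rewrite /coact_eval -tlift_split; apply: eq_tlift => m0 m1.
  by rewrite dualDl (rmodADr ractP).
- rewrite /coact_eval (morph_tlift (F := fun m => c *: m)); last exact: scalerDr.
  by apply: eq_tlift => m0 m1; rewrite dualZl (rmodAZ ractP).
Qed.

(** The source of U_* acts as the given right A-action and, by the next lemma, its target as the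
    induced left one. Coincidence of the bimodule structures thus becomes [pair_src] and
    [pair_tgt]. *)
Lemma coact_eval_s m a : coact_eval m (ds a) = ract m a.
Proof.
rewrite -[in RHS](rcoact_counit rhoP m) (morph_tlift (F := fun m => ract m a)).
  by apply: eq_tlift => m0 m1; rewrite dual_sE (rmodAM ractP).
by move=> x y; apply: rmodADl.
Qed.

Lemma coact_eval_t m a : coact_eval m (dt a) = comod_lact rho a m.
Proof. by apply: eq_tlift => m0 m1; rewrite dual_tE lcounit_mul_tgt. Qed.

End LeftRightComodule.

(** * Evaluation of the left-right axioms on U_* *)

Section LeftRightPair.
Variables (k : comPzRingType) (A U : algType k) (L : left_bialgebroid A U).
Variable U_fgp : is_fgp (src_mod L).
Local Notation s := (lsrc L).
Local Notation t := (ltgt L).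
Local Notation Delta := (lcoprod L).
Local Notation V := (dual L).
Local Notation dt := (dual_t L).
Local Notation dDelta := (dual_coprod U_fgp).

Section YDEval.
Variables (M : lmodType k) (lact : U -> M -> M) (ract : M -> A -> M).
Variable rho : M -> tensor ract (tri_l s).
Hypotheses (lactP : is_left_module lact) (rhoP : is_right_comodule rho).
Hypothesis lact_t : forall a m, lact (t a) m = ract m a.

Let ractP := rcomod_module rhoP.

Let ract_lact_bal (m0 : M) (psi : V) :
  balanced (tri_r t) (tri_l s) (fun u1 u2 => ract (lact u1 m0) (psi u2)).
Proof.
split=> [x y z|x y z|x a y].
- by rewrite (lmodADl lactP) (rmodADl ractP).
- by rewrite dualD (rmodADr ractP).
- by rewrite /tri_r /tri_l (lmodAM lactP) lact_t (ractS rhoP).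
Qed.

(** The value psi(u_(2) m_[1]) is psi2(u_(2) s(psi1(m_[1]))). The Takeuchi property trades the inner
    s for a t to the right of u_(1), where it acts on m_[0] from the right; the sum over the
    coaction then gives m psi1. *)
Lemma eval_YD_left u (psi : V) m :
  tlift (fun m0 m1 => ract m0 (psi m1))
    (tlift (fun m0 m1 =>
        tlift (fun u1 u2 => lact u1 m0 ⊗ (u2 * m1)) (Delta u)) (rho m)
      : tensor ract (tri_l s)) =
  tlift (fun u1 u2 => tlift (fun psi1 psi2 : V =>
      ract (lact u1 (coact_eval rho m psi1)) (psi2 u2)) (dDelta psi)) (Delta u).
Proof.
have eb := balanced_coact_eval rhoP psi.
rewrite (tlift_tlift _ _ eb).
transitivity (tlift (fun m0 m1 => tlift (fun u1 u2 => tlift (fun psi1 psi2 : V =>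
   ract (lact u1 (ract m0 (psi1 m1))) (psi2 u2)) (dDelta psi)) (Delta u)) (rho m)).
  apply: eq_tlift => m0 m1; rewrite (tlift_tlift _ _ eb) [RHS]tlift_exchange.
  (* With m_[1], psi1 and psi2 fixed, the sum over Delta u is innermost, where the Takeuchi identity
     applies. *)
  transitivity (tlift (fun psi1 psi2 : V => tlift (fun u1 u2 =>
      ract (lact u1 m0) (psi2 (u2 * s (psi1 m1)))) (Delta u)) (dDelta psi)).
    rewrite [RHS]tlift_exchange; apply: eq_tlift => u1 u2; rewrite (tlift_tens eb).
    rewrite -(dual_coprodE U_fgp psi) (morph_tlift (F := ract (lact u1 m0))) //.
    exact: rmodADr.
  apply: eq_tlift => psi1 psi2.
  rewrite -(ev_takeuchi (ract_lact_bal m0 psi2)).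
  by apply: eq_tlift => u1 u2; rewrite (lmodAM lactP) lact_t.
rewrite [LHS]tlift_exchange; apply: eq_tlift => u1 u2.
rewrite [LHS]tlift_exchange; apply: eq_tlift => psi1 psi2.
rewrite [RHS](morph_tlift (F := fun m => ract (lact u1 m) (psi2 u2))) // => x y.
by rewrite (lmodADr lactP) (rmodADl ractP).
Qed.

Lemma eval_YD_right u (psi : V) m :
  tlift (fun m0 m1 => ract m0 (psi m1))
    (tlift (fun u1 u2 =>
        tlift (fun n0 n1 => n0 ⊗ (n1 * u1)) (rho (lact u2 m))) (Delta u)
      : tensor ract (tri_l s)) =
  tlift (fun u1 u2 => coact_eval rho (lact u2 m) (dual_shift psi u1)) (Delta u).
Proof.
have eb := balanced_coact_eval rhoP psi.
rewrite (tlift_tlift _ _ eb); apply: eq_tlift => u1 u2; rewrite (tlift_tlift _ _ eb).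
by apply: eq_tlift => m0 m1; rewrite (tlift_tens eb).
Qed.
End YDEval.

Section MonoidEval.
Variables (R : algType k) (lact : U -> R -> R) (ract : R -> A -> R).
Variable rho : R -> tensor ract (tri_l s).
Hypotheses (lactP : is_left_module lact) (rhoP : is_right_comodule rho).
Hypothesis lact_s : forall a r, coact_eval rho r (dt a) = lact (s a) r.
Hypothesis bilinr : forall a r r', ract (r * r') a = r * ract r' a.
Hypothesis balance : forall a r r', ract r a * r' = r * lact (s a) r'.

Let ractP := rcomod_module rhoP.

Lemma eval_coactM (psi : V) r r' :
  tlift (fun m0 m1 => ract m0 (psi m1))
    (tlift (fun r0 r1 =>
        tlift (fun r0' r1' => (r0 * r0') ⊗ (r1' * r1)) (rho r')) (rho r)
      : tensor ract (tri_l s)) =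
  tlift (fun psi1 psi2 : V => coact_eval rho r psi1 * coact_eval rho r' psi2)
    (dDelta psi).
Proof.
have eb := balanced_coact_eval rhoP psi; rewrite (tlift_tlift _ _ eb).
transitivity (tlift (fun psi1 psi2 : V => tlift (fun r0 r1 =>
    r0 * tlift (fun r0' r1' => ract r0' (psi2 (r1' * s (psi1 r1)))) (rho r'))
    (rho r)) (dDelta psi)).
  rewrite [RHS]tlift_exchange; apply: eq_tlift => r0 r1.
  rewrite (tlift_tlift _ _ eb) -[RHS](morph_tlift (F := *%R r0)); last exact: mulrDr.
  rewrite [in RHS]tlift_exchange [RHS](morph_tlift (F := *%R r0)); last exact: mulrDr.
  apply: eq_tlift => r0' r1'; rewrite (tlift_tens eb) bilinr; congr (_ * _).
  rewrite -(dual_coprodE U_fgp psi) (morph_tlift (F := ract r0')) //.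
  exact: rmodADr.
apply: eq_tlift => psi1 psi2.
rewrite (morph_tlift (F := fun x => x * coact_eval rho r' psi2)); last first.
  by move=> x y; rewrite mulrDl.
(* The balance moves psi1(r_[1]) to the left of r' psi2. There it acts through the target of U_* and
   is absorbed into psi2, which produces the argument r'_[1] s(psi1(r_[1])). *)
apply: eq_tlift => r0 r1; rewrite balance -lact_s.
rewrite -(rmodAM (coact_eval_right_module rhoP)) /coact_eval.
by congr (_ * _); apply: eq_tlift => r0' r1'; rewrite dual_mul_t_r.
Qed.

Lemma eval_braiding n (e : 'I_n -> U) (f : 'I_n -> V) r r' :
  is_dual_basis e f ->
  tlift (fun r0' r1' => r0' * lact r1' r) (rho r') =
  \sum_j coact_eval rho r' (f j) * lact (e j) r.
Proof.
move=> ef.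
transitivity (\sum_j tlift (fun r0 r1 => ract r0 (f j r1) * lact (e j) r) (rho r')).
  rewrite -tlift_bigsum; apply: eq_tlift => r0 r1.
  rewrite [r1 in LHS]ef (lact_suml lactP) mulr_sumr; apply: eq_bigr => j _.
  by rewrite balance (lmodAM lactP).
apply: eq_bigr => j _.
by rewrite -[LHS](morph_tlift (F := fun x => x * lact (e j) r)) // => x y; rewrite mulrDl.
Qed.
End MonoidEval.

Lemma lr_YD_pair (M : lmodType k) (D : lr_data L M) :
  is_lr_YD D -> is_YD_pair U_fgp (lr_act D) (coact_eval (lr_coact D)).
Proof.
move=> DP; have lactP := lr_module DP; have rhoP := lr_comodule DP.
split=> //; first exact: coact_eval_right_module.
- by move=> a m; rewrite coact_eval_t (lr_bimod_l DP).
- by move=> a m; rewrite (coact_eval_s rhoP) (lr_bimod_r DP).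
move=> u psi m; rewrite -(eval_YD_right _ rhoP) -(lr_YD DP).
rewrite (eval_YD_left lactP rhoP (lr_bimod_r DP)).
apply: eq_tlift => u1 u2; apply: eq_tlift => psi1 psi2.
by rewrite (coact_eval_s rhoP).
Qed.

Lemma lr_monoid_pair (R : algType k) (D : lr_data L R) :
  is_lr_monoid D -> is_monoid_pair U_fgp (lr_act D) (coact_eval (lr_coact D)).
Proof.
move=> DP; have ydP := lr_monoid_YD DP; have rhoP := lr_comodule ydP.
have pairP := lr_YD_pair ydP; split=> //.
- exact: lr_actM.
- move=> psi r r'; rewrite -(eval_coactM rhoP (pair_src pairP)).
  + by rewrite -(lr_coactM DP).
  + exact: lr_bilinr.
  + exact: lr_balance.
- exact: lr_act1.
- move=> psi; rewrite (coact_eval_s rhoP) /coact_eval (lr_coact1 DP).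
  by rewrite (tlift_tens (balanced_coact_eval rhoP psi)).
- exact: lr_bilinl.
- by move=> a r r'; rewrite !(coact_eval_s rhoP) (lr_bilinr DP).
- by move=> a r r'; rewrite !(coact_eval_s rhoP) (lr_balance DP).
Qed.

Lemma lr_pair_braided_commutative (R : algType k) (D : lr_data L R) n
    (e : 'I_n -> U) (f : 'I_n -> V) :
  is_dual_basis e f -> is_lr_monoid D -> lr_braided_commutative D ->
  pair_braided_commutative (lr_act D) (coact_eval (lr_coact D)) e f.
Proof.
move=> ef DP bc r r'; rewrite bc; apply: eval_braiding ef.
  exact: lr_module (lr_monoid_YD DP).
exact: lr_balance.
Qed.
End LeftRightPair.

(** * From a pair of actions to left-right structures *)

Section PairToLeftRight.
Variables (k : comPzRingType) (A U : algType k) (L : left_bialgebroid A U).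
Variable U_fgp : is_fgp (src_mod L).
Variables (n : nat) (e : 'I_n -> U) (f : 'I_n -> dual L).
Hypothesis ef : is_dual_basis e f.
Local Notation s := (lsrc L).
Local Notation t := (ltgt L).
Local Notation V := (dual L).
Local Notation ds := (dual_s L).
Local Notation UU := (tensor (tri_r t) (tri_l s)).

Lemma dualM_bal_src (psi phi : V) a T :
  tlift (fun x y => phi (t (psi y) * x)) (tensl (tri_l s) a T : UU) =
  a * tlift (fun x y => phi (t (psi y) * x)) T.
Proof.
rewrite (tlift_tlift _ _ (dual_mul_bal psi phi)) [RHS]morph_tlift; last exact: mulrDr.
apply: eq_tlift => x y; rewrite (tlift_tens (dual_mul_bal psi phi)).
by rewrite -dual_src /tri_l !mulrA lsrc_tgt.
Qed.

Lemma tens_tri_l_bal a :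
  balanced (tri_r t) (tri_l s) (fun x y => tri_l s a x ⊗ y : UU).
Proof.
split=> [x y z|x y z|x b y]; rewrite /tri_l /tri_r ?mulrDr ?tensDl ?tensDr //.
by rewrite mulrA lsrc_tgt -mulrA; apply: tens_bal.
Qed.

(** The e_i ⊗ e_j form a dual basis of U ⊗_A U: expand y along the e_j, move the coefficient to x as
    t(f_j(y)), then expand along the e_i. On Delta u the coordinate (i, j) is the value of f_j f_i
    at u, which ties coassociativity to the product of U_*. *)
Lemma tensor_basisE (T : UU) :
  T = \sum_(p : 'I_n * 'I_n) tensl (tri_l s)
    (tlift (fun x y => f p.1 (t (f p.2 y) * x)) T) (e p.1 ⊗ e p.2).
Proof.
transitivity (tlift (fun x y => \sum_(p : 'I_n * 'I_n)
    (s (f p.1 (t (f p.2 y) * x)) * e p.1) ⊗ e p.2 : UU) T); last first.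
  rewrite tlift_bigsum; apply: eq_bigr => p _.
  rewrite /tensl (tlift_tens (tens_tri_l_bal _)) /tri_l.
  rewrite -[LHS](morph_tlift (F := fun a => (s a * e p.1) ⊗ e p.2 : UU)) //.
  by move=> x y; rewrite raddfD mulrDl tensDl.
rewrite -[LHS]tlift_repr; apply: eq_tlift => x y.
rewrite -(pair_bigA _ (fun i j => (s (f i (t (f j y) * x)) * e i) ⊗ e j : UU)).
rewrite exchange_big /=.
rewrite [y in LHS]ef tens_sumr; apply: eq_bigr => j _.
by rewrite -tens_bal /tri_r [_ * x in LHS]ef tens_suml.
Qed.

Section YD.
Variables (M : lmodType k) (lact : U -> M -> M) (ract : M -> V -> M).
Hypothesis MP : is_YD_pair U_fgp lact ract.

Let lactP := pair_left MP.
Let ractP := pair_right MP.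
Local Notation mr := (fun (m : M) (a : A) => ract m (ds a)).

Definition pair_coact (m : M) : tensor mr (tri_l s) := \sum_j ract m (f j) ⊗ e j.
Definition pair_lr : lr_data L M := LRData lact pair_coact.

Lemma pair_ract_module : is_right_module mr.
Proof.
split=> [m|m a b|m m' a|m a b|c m a].
- by rewrite rmorph1 (rmodA1 ractP).
- by rewrite rmorphM (rmodAM ractP).
- exact: rmodADl.
- by rewrite raddfD (rmodADr ractP).
- by rewrite linearZ (rmodAZ ractP).
Qed.

Let mrP := pair_ract_module.

Lemma balanced_ract_eval (psi : V) :
  balanced mr (tri_l s) (fun m0 m1 => mr m0 (psi m1)).
Proof.
split=> [m m' x|m x x'|m a x]; first exact: rmodADl.
- by rewrite dualD (rmodADr mrP).
- by rewrite -(rmodAM mrP) /tri_l dual_src.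
Qed.

(** Since psi is the sum of the f_j ds(psi(e_j)), evaluating the rebuilt coaction returns the
    original action. *)
Lemma pair_coactE m psi : coact_eval pair_coact m psi = ract m psi.
Proof.
rewrite /coact_eval (tlift_sum_tens _ _ _ (balanced_ract_eval psi)).
rewrite [psi in RHS](dual_basisE ef) (ract_sumr ractP).
by apply: eq_bigr => j _; rewrite (rmodAM ractP).
Qed.

Lemma ract_tens_inj (T T' : tensor mr (tri_l s)) :
  (forall psi : V, tlift (fun m0 m1 => mr m0 (psi m1)) T =
                   tlift (fun m0 m1 => mr m0 (psi m1)) T') -> T = T'.
Proof. by move=> h; apply: (tens_inj_basis (h := f) ef) => j; apply: h. Qed.

Lemma pair_comodule : is_right_comodule pair_coact.
Proof.
split=> //.
- move=> m m'; rewrite /pair_coact -big_split; apply: eq_bigr => j _.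
  by rewrite (rmodADl ractP) tensDl.
- move=> m a; apply: ract_tens_inj => psi; have eb := balanced_ract_eval psi.
  rewrite (tlift_tlift _ _ eb) [LHS]pair_coactE.
  transitivity (coact_eval pair_coact m (ds a * psi)).
    by rewrite pair_coactE (rmodAM ractP).
  by apply: eq_tlift => m0 m1; rewrite (tlift_tens eb) dual_mul_s_l.
(* In coordinate (i, j), one side of coassociativity is (m f_j) f_i and the other is m (f_j f_i). *)
- move=> m; apply: (tens_inj_basis tensor_basisE) => -[i j] /=.
  have b2 : balanced mr (tensl (tri_l s)) (fun m0 (T : UU) =>
      mr m0 (tlift (fun x y => f i (t (f j y) * x)) T)).
    split=> [x x' T|x T T'|x a T]; first exact: rmodADl.
    + by rewrite (tliftD (dual_mul_bal _ _)) (rmodADr mrP).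
    + by rewrite dualM_bal_src (rmodAM mrP).
  rewrite !(tlift_tlift _ _ b2).
  transitivity (ract m (f j * f i)); last first.
    rewrite -pair_coactE; apply: eq_tlift => m0 m1.
    by rewrite (tlift_tens b2) dualM.
  rewrite (rmodAM ractP) -[ract m (f j)]pair_coactE.
  rewrite (morph_tlift (F := fun m => ract m (f i))) => [|x y]; last exact: rmodADl.
  apply: eq_tlift => m0 m1; rewrite (tlift_tlift _ _ b2) -(rmodAM ractP).
  rewrite -pair_coactE; apply: eq_tlift => n0 n1.
  by rewrite (tlift_tens b2) (tlift_tens (dual_mul_bal _ _)) dual_mul_s_l.
- by move=> m; have := pair_coactE m 1; rewrite (rmodA1 ractP).
Qed.

Lemma pair_lr_YD : is_lr_YD pair_lr.
Proof.
have rhoP := pair_comodule; split=> //=.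
- by move=> a m; rewrite -(pair_src MP) -pair_coactE coact_eval_t.
- by move=> a m; rewrite (pair_tgt MP).
move=> u m; apply: ract_tens_inj => psi.
rewrite (eval_YD_left U_fgp lactP rhoP (pair_tgt MP)) (eval_YD_right _ rhoP).
under [RHS]eq_tlift do rewrite pair_coactE.
rewrite (pair_YD MP); apply: eq_tlift => u1 u2; apply: eq_tlift => psi1 psi2.
by rewrite pair_coactE.
Qed.
End YD.

Section Monoid.
Variables (R : algType k) (lact : U -> R -> R) (ract : R -> V -> R).
Hypothesis RP : is_monoid_pair U_fgp lact ract.

Let ydP := mpair_YD RP.

Lemma pair_lr_monoid : is_lr_monoid (pair_lr lact ract).
Proof.
have rhoP := pair_comodule ydP; split=> /=.
- exact: pair_lr_YD.
- exact: mpair_lactM RP.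
- exact: mpair_lact1 RP.
- exact: mpair_bilinl RP.
- exact: mpair_bilinr RP.
- exact: mpair_balance RP.
- move=> r r'; apply: ract_tens_inj => psi.
  rewrite (eval_coactM U_fgp rhoP _ (mpair_bilinr RP) (mpair_balance RP)).
    rewrite [LHS](pair_coactE ydP) (mpair_ractM RP).
    by apply: eq_tlift => psi1 psi2; rewrite !(pair_coactE ydP).
  by move=> a r0; rewrite (pair_coactE ydP) (pair_src ydP).
- apply: ract_tens_inj => psi; rewrite [LHS](pair_coactE ydP).
  by rewrite (tlift_tens (balanced_ract_eval ydP psi)) (mpair_ract1 RP).
Qed.

Lemma pair_lr_braided_commutative :
  pair_braided_commutative lact ract e f -> lr_braided_commutative (pair_lr lact ract).
Proof.
move=> bc r r'; rewrite bc.
rewrite [RHS](eval_braiding (pair_coact ract) (pair_left ydP) (mpair_balance RP) _ _ ef).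
by apply: eq_bigr => j _; rewrite (pair_coactE ydP).
Qed.
End Monoid.
End PairToLeftRight.

(** * Left U_*-comodules and evaluation of the right-left axioms on U *)

Section RightLeftComodule.
Variables (k : comPzRingType) (A U : algType k) (L : left_bialgebroid A U).
Variable U_fgp : is_fgp (src_mod L).
Local Notation s := (lsrc L).
Local Notation t := (ltgt L).
Local Notation Delta := (lcoprod L).
Local Notation V := (dual L).
Local Notation ds := (dual_s L).
Local Notation dt := (dual_t L).
Local Notation dDelta := (dual_coprod U_fgp).
Local Notation Ud := (dual_bialgebroid U_fgp).

Section Comodule.
Variables (M : lmodType k) (lact : A -> M -> M).
Variable lam : M -> tensor (btri_r ds) lact.
Hypothesis lamP : is_left_comodule (W := Ud) lam.

Let lactP := lcomod_module lamP.

Definition dual_coact_eval (u : U) (m : M) : M :=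
  tlift (fun (psi : V) m0 => lact (psi u) m0) (lam m).

Lemma balanced_dual_coact_eval u :
  balanced (btri_r ds) lact (fun (psi : V) m0 => lact (psi u) m0).
Proof.
split=> [psi phi m|psi m m'|psi a m].
- by rewrite dualDl (lmodADl lactP).
- exact: lmodADr.
- by rewrite /btri_r dual_mul_s_r (lmodAM lactP).
Qed.

Lemma ev_dual_coact_lact (Z : zmodType) (g : V -> M -> Z) a m :
  balanced (btri_r ds) lact g ->
  tlift g (lam (lact a m)) = tlift (fun (psi : V) m0 => g (psi * dt a) m0) (lam m).
Proof.
move=> gb; rewrite [lam _](lcoact_lin lamP) (tlift_tlift _ _ gb).
by apply: eq_tlift => x y; apply: tlift_tens gb _ _.
Qed.

Lemma dual_coact_evalD u : {morph dual_coact_eval u : m m' / m + m'}.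
Proof.
move=> m m'; rewrite /dual_coact_eval (lcoactD lamP).
exact: tliftD (balanced_dual_coact_eval u) _ _.
Qed.

(** Here (u v) m expands by psi(u v) = psi2(u s(psi1(v))). Coassociativity replaces the split of psi
    by a second coaction, and linearity of the coaction identifies the result with u (v m). *)
Lemma dual_coact_eval_module : is_left_module dual_coact_eval.
Proof.
split=> [m|u v m|u m m'|u v m|c u m].
- exact: lcoact_counit lamP m.
- have b3 : balanced (btri_r ds) (tensl (btri_l dt))
      (fun (phi : V) (T : tensor (btri_r ds) lact) =>
        tlift (fun (psi : V) m0 => lact (psi (u * s (phi v))) m0) T).
    split=> [phi phi' T|phi T T'|phi a T].
    + rewrite -tlift_split; apply: eq_tlift => psi m0.
      by rewrite dualDl raddfD mulrDr dualD (lmodADl lactP).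
    + exact: tliftD (balanced_dual_coact_eval _) _ _.
    + rewrite /tensl (tlift_tlift _ _ (balanced_dual_coact_eval _)).
      apply: eq_tlift => psi m0.
      rewrite (tlift_tens (balanced_dual_coact_eval _)) /btri_l /btri_r.
      by rewrite dual_mul_t_r dual_mul_s_r rmorphM mulrA.
  have := congr1 (tlift (fun (phi : V) (T : tensor (btri_r ds) lact) =>
        tlift (fun (psi : V) m0 => lact (psi (u * s (phi v))) m0) T))
    (lcoact_coassoc lamP m).
  rewrite !(tlift_tlift _ _ b3) => h.
  transitivity (tlift (fun (psi : V) m0 => tlift (fun psi1 psi2 : V =>
      lact (psi2 (u * s (psi1 v))) m0) (dDelta psi)) (lam m)).
    apply: eq_tlift => psi m0; rewrite -(dual_coprodE U_fgp psi u v).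
    rewrite (morph_tlift (F := fun a => lact a m0)) // => a b.
    exact: lmodADl.
  transitivity (tlift (fun (psi : V) m0 => tlift (fun (phi : V) T =>
      tlift (fun (psi : V) m0 => lact (psi (u * s (phi v))) m0) T)
      (tlift (fun v1 v2 => v1 ⊗ (v2 ⊗ m0)) (dDelta psi) :
        tensor (btri_r ds) (tensl (btri_l dt) : A -> tensor (btri_r ds) lact -> _)))
      (lam m)).
    apply: eq_tlift => psi m0; rewrite (tlift_tlift _ _ b3).
    apply: eq_tlift => psi1 psi2.
    by rewrite (tlift_tens b3) (tlift_tens (balanced_dual_coact_eval _)).
  rewrite [LHS]h [RHS](morph_tlift (F := dual_coact_eval u)); last exact: dual_coact_evalD.
  apply: eq_tlift => psi m0; rewrite (tlift_tens b3).
  rewrite /dual_coact_eval (ev_dual_coact_lact _ _ (balanced_dual_coact_eval u)).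
  by apply: eq_tlift => phi n0; rewrite dual_mul_t_r.
- exact: dual_coact_evalD.
- rewrite /dual_coact_eval -tlift_split; apply: eq_tlift => psi m0.
  by rewrite dualD (lmodADl lactP).
- rewrite /dual_coact_eval (morph_tlift (F := fun m => c *: m)); last exact: scalerDr.
  by apply: eq_tlift => psi m0; rewrite dualZr (lmodAZ lactP).
Qed.

Lemma dual_coact_eval_s a m : dual_coact_eval (s a) m = lact a m.
Proof.
rewrite -[in RHS](lcoact_counit lamP m) (morph_tlift (F := lact a)); last exact: lmodADr.
by apply: eq_tlift => psi m0; rewrite -(lmodAM lactP) -[s a]mulr1 dual_src.
Qed.

Lemma dual_coact_eval_t a m : dual_coact_eval (t a) m = comod_ract (W := Ud) lam m a.
Proof.
apply: eq_tlift => psi m0; congr (lact _ m0).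
by rewrite [RHS]dual_mul_t_l mul1r.
Qed.

End Comodule.

Section YDEval.
Variables (M : lmodType k) (lact : A -> M -> M) (ract : M -> V -> M).
Variable lam : M -> tensor (btri_r ds) lact.
Hypotheses (ractP : is_right_module ract) (lamP : is_left_comodule (W := Ud) lam).
Hypothesis ract_t : forall a m, ract m (dt a) = lact a m.
Hypothesis ract_s : forall a m, dual_coact_eval lam (t a) m = ract m (ds a).

Let lactP := lcomod_module lamP.

(** The product m^(-1) psi1 evaluated at u is psi1(t(m^(-1)(u_(2))) u_(1)), acting through [dt]
    behind psi2. *)
Lemma dual_eval_YD_left u (psi : V) m :
  tlift (fun (phi : V) m0 => lact (phi u) m0)
    (tlift (fun m1 m0 =>
        tlift (fun psi1 psi2 : V => (m1 * psi1) ⊗ ract m0 psi2) (dDelta psi)) (lam m)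
      : tensor (btri_r ds) lact) =
  tlift (fun u1 u2 => ract (dual_coact_eval lam u2 m) (dual_shift psi u1)) (Delta u).
Proof.
have eb := balanced_dual_coact_eval lamP u.
rewrite (tlift_tlift _ _ eb).
transitivity (tlift (fun (m1 : V) m0 => tlift (fun u1 u2 =>
    ract (lact (m1 u2) m0) (dual_shift psi u1)) (Delta u)) (lam m)).
  apply: eq_tlift => m1 m0; rewrite (tlift_tlift _ _ eb).
  transitivity (tlift (fun u1 u2 => tlift (fun psi1 psi2 : V =>
      ract m0 (psi2 * dt (psi1 (t (m1 u2) * u1)))) (dDelta psi)) (Delta u)).
    rewrite [RHS]tlift_exchange; apply: eq_tlift => psi1 psi2.
    rewrite (tlift_tens eb) dualM (morph_tlift (F := fun a => lact a (ract m0 psi2))).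
      by apply: eq_tlift => u1 u2; rewrite (rmodAM ractP) ract_t.
    by move=> a b; apply: lmodADl.
  apply: eq_tlift => u1 u2; rewrite -(morph_tlift (F := ract m0)); last exact: rmodADr.
  (* The sum over the coproduct collapses to the shift of psi by t(a) u_(1), with a = m^(-1)(u_(2)).
     The factor t(a) comes out on the left as [dt a], where it acts on m^(0) as a. *)
  rewrite dual_shift_coprod -ract_t -(rmodAM ractP); congr (ract m0 _).
  by apply: dualP => x; rewrite dual_mul_t_l !dual_shiftE mulrA.
rewrite [LHS]tlift_exchange; apply: eq_tlift => u1 u2.
rewrite [RHS](morph_tlift (F := fun m => ract m (dual_shift psi u1))) // => x y.
exact: rmodADl.
Qed.

Lemma dual_eval_YD_right u (psi : V) m :
  tlift (fun (phi : V) m0 => lact (phi u) m0)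
    (tlift (fun psi1 psi2 : V =>
        tlift (fun n1 n0 => (psi2 * n1) ⊗ n0) (lam (ract m psi1))) (dDelta psi)
      : tensor (btri_r ds) lact) =
  tlift (fun u1 u2 => tlift (fun psi1 psi2 : V =>
      ract (dual_coact_eval lam u1 (ract m psi1)) (ds (psi2 u2))) (dDelta psi))
    (Delta u).
Proof.
have eb := balanced_dual_coact_eval lamP u.
rewrite (tlift_tlift _ _ eb) [RHS]tlift_exchange; apply: eq_tlift => psi1 psi2.
rewrite (tlift_tlift _ _ eb).
transitivity (tlift (fun u1 u2 => tlift (fun (n1 : V) n0 =>
    lact (n1 (t (psi2 u2) * u1)) n0) (lam (ract m psi1))) (Delta u)).
  rewrite [RHS]tlift_exchange; apply: eq_tlift => n1 n0.
  rewrite (tlift_tens eb) dualM (morph_tlift (F := fun a => lact a n0)) // => a b.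
  exact: lmodADl.
apply: eq_tlift => u1 u2.
by rewrite -ract_s -(lmodAM (dual_coact_eval_module lamP)).
Qed.
End YDEval.

Section MonoidEval.
Variables (R : algType k) (lact : A -> R -> R) (ract : R -> V -> R).
Variable lam : R -> tensor (btri_r ds) lact.
Hypotheses (ractP : is_right_module ract) (lamP : is_left_comodule (W := Ud) lam).
Hypothesis ract_s : forall a r, dual_coact_eval lam (t a) r = ract r (ds a).
Hypothesis bilinl : forall a r r', lact a (r * r') = lact a r * r'.
Hypothesis balance : forall a r r', ract r (ds a) * r' = r * lact a r'.

Let lactP := lcomod_module lamP.

(** The product r'^(-1) r^(-1) at u is r^(-1)(t(r'^(-1)(u_(2))) u_(1)). The t acts on u_(1) r as a
    right A-action, and the balance hands it over to r'^(0), leaving u_(2) r'. *)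
Lemma dual_eval_coactM u r r' :
  tlift (fun (phi : V) m0 => lact (phi u) m0)
    (tlift (fun r1' r0' =>
        tlift (fun r1 r0 => (r1' * r1) ⊗ (r0 * r0')) (lam r)) (lam r')
      : tensor (btri_r ds) lact) =
  tlift (fun u1 u2 => dual_coact_eval lam u1 r * dual_coact_eval lam u2 r') (Delta u).
Proof.
have eb := balanced_dual_coact_eval lamP u; rewrite (tlift_tlift _ _ eb).
transitivity (tlift (fun u1 u2 => tlift (fun (r1' : V) r0' =>
    tlift (fun (r1 : V) r0 => lact (r1 (t (r1' u2) * u1)) r0) (lam r) * r0')
    (lam r')) (Delta u)).
  rewrite [RHS]tlift_exchange; apply: eq_tlift => r1' r0'.
  rewrite (tlift_tlift _ _ eb) -[RHS](morph_tlift (F := fun x => x * r0')); last first.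
    by move=> x y; rewrite mulrDl.
  rewrite [in RHS]tlift_exchange [RHS](morph_tlift (F := fun x => x * r0')); last first.
    by move=> x y; rewrite mulrDl.
  apply: eq_tlift => r1 r0; rewrite (tlift_tens eb) bilinl dualM; congr (_ * _).
  by rewrite (morph_tlift (F := fun a => lact a r0)) // => a b; apply: lmodADl.
apply: eq_tlift => u1 u2.
rewrite [RHS](morph_tlift (F := *%R (dual_coact_eval lam u1 r))); last exact: mulrDr.
apply: eq_tlift => r1' r0'; rewrite -balance -ract_s.
by rewrite -(lmodAM (dual_coact_eval_module lamP)).
Qed.

Lemma dual_eval_braiding n (e : 'I_n -> U) (f : 'I_n -> V) r r' :
  is_dual_basis e f ->
  tlift (fun (r1 : V) r0 => ract r' r1 * r0) (lam r) =
  \sum_j ract r' (f j) * dual_coact_eval lam (e j) r.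
Proof.
move=> ef.
transitivity (\sum_j tlift (fun (r1 : V) r0 => ract r' (f j) * lact (r1 (e j)) r0) (lam r)).
  rewrite -tlift_bigsum; apply: eq_tlift => r1 r0.
  rewrite [r1 in LHS](dual_basisE ef) (ract_sumr ractP) mulr_suml; apply: eq_bigr => j _.
  by rewrite (rmodAM ractP) balance.
apply: eq_bigr => j _.
by rewrite -[LHS](morph_tlift (F := *%R (ract r' (f j)))) // => x y; rewrite mulrDr.
Qed.
End MonoidEval.

Lemma rl_YD_pair (M : lmodType k) (D : rl_data Ud M) :
  is_rl_YD D -> is_YD_pair U_fgp (dual_coact_eval (rl_coact D)) (rl_act D).
Proof.
move=> DP; have ractP := rl_module DP; have lamP := rl_comodule DP.
have actT a m : rl_act D m (dt a) = rl_lact D a m := rl_bimod_l DP a m.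
have actS a m : dual_coact_eval (rl_coact D) (t a) m = rl_act D m (ds a).
  by rewrite dual_coact_eval_t -(rl_bimod_r DP).
split=> //; first exact: dual_coact_eval_module.
- by move=> a m; rewrite actT (dual_coact_eval_s lamP).
move=> u psi m; rewrite -(dual_eval_YD_left ractP lamP actT).
by rewrite -(dual_eval_YD_right lamP actS) -(rl_YD DP).
Qed.

Lemma rl_monoid_pair (R : algType k) (D : rl_data Ud R) :
  is_rl_monoid D -> is_monoid_pair U_fgp (dual_coact_eval (rl_coact D)) (rl_act D).
Proof.
move=> DP; have ydP := rl_monoid_YD DP; have lamP := rl_comodule ydP.
have pairP := rl_YD_pair ydP; have ractP := rl_module ydP.
(* The two-sided bilinearity axiom is split into its halves by putting 1 for one of the scalars:
   here on the right, later on the left. *)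
have bilinl a r r' : rl_lact D a (r * r') = rl_lact D a r * r'.
  by have := rl_bilin DP a 1 r r'; rewrite rmorph1 !(rmodA1 ractP).
split=> //.
- move=> u r r'.
  rewrite -(dual_eval_coactM lamP (pair_tgt pairP) bilinl (rl_balance DP)).
  by rewrite -(rl_coactM DP).
- by move=> psi r r'; rewrite (rl_actM DP).
- move=> u; rewrite (dual_coact_eval_s lamP) /dual_coact_eval (rl_coact1 DP).
  exact: tlift_tens (balanced_dual_coact_eval lamP u) _ _.
- exact: rl_act1.
- by move=> a r r'; rewrite !(dual_coact_eval_s lamP).
- move=> a r r'; have := rl_bilin DP 1 a r r'.
  by rewrite !(lmodA1 (lcomod_module lamP)).
- by move=> a r r'; rewrite (dual_coact_eval_s lamP); apply: (rl_balance DP).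
Qed.

Lemma rl_pair_braided_commutative (R : algType k) (D : rl_data Ud R) n
    (e : 'I_n -> U) (f : 'I_n -> V) :
  is_dual_basis e f -> is_rl_monoid D -> rl_braided_commutative D ->
  pair_braided_commutative (dual_coact_eval (rl_coact D)) (rl_act D) e f.
Proof.
move=> ef DP bc r r'; rewrite bc; apply: dual_eval_braiding ef.
  exact: rl_module (rl_monoid_YD DP).
exact: rl_balance DP.
Qed.
End RightLeftComodule.

(** * From a pair of actions to right-left structures *)

Section PairToRightLeft.
Variables (k : comPzRingType) (A U : algType k) (L : left_bialgebroid A U).
Variable U_fgp : is_fgp (src_mod L).
Variables (n : nat) (e : 'I_n -> U) (f : 'I_n -> dual L).
Hypothesis ef : is_dual_basis e f.
Local Notation s := (lsrc L).
Local Notation t := (ltgt L).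
Local Notation V := (dual L).
Local Notation ds := (dual_s L).
Local Notation dt := (dual_t L).
Local Notation Ud := (dual_bialgebroid U_fgp).

Section YD.
Variables (M : lmodType k) (lact : U -> M -> M) (ract : M -> V -> M).
Hypothesis MP : is_YD_pair U_fgp lact ract.

Let lactP := pair_left MP.
Let ractP := pair_right MP.
Local Notation ml := (fun (a : A) (m : M) => lact (s a) m).

Definition pair_dual_coact (m : M) : tensor (btri_r ds) ml :=
  \sum_j f j ⊗ lact (e j) m.
Definition pair_rl : rl_data Ud M :=
  @RLData _ _ _ Ud M ract (fun a m => lact (s a) m) pair_dual_coact.

Lemma pair_lact_module : is_left_module ml.
Proof.
split=> [m|a b m|a m m'|a b m|c a m].
- by rewrite rmorph1 (lmodA1 lactP).
- by rewrite rmorphM (lmodAM lactP).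
- exact: lmodADr.
- by rewrite raddfD (lmodADl lactP).
- by rewrite linearZ (lmodAZ lactP).
Qed.

Let mlP := pair_lact_module.

Lemma balanced_lact_eval u :
  balanced (btri_r ds) ml (fun (psi : V) m => ml (psi u) m).
Proof.
split=> [psi phi m|psi m m'|psi a m].
- by rewrite dualDl (lmodADl mlP).
- exact: lmodADr.
- by rewrite /btri_r dual_mul_s_r -(lmodAM mlP).
Qed.

Lemma pair_dual_coactE u m : dual_coact_eval pair_dual_coact u m = lact u m.
Proof.
rewrite /dual_coact_eval (tlift_sum_tens _ _ _ (balanced_lact_eval u)).
rewrite [u in RHS]ef (lact_suml lactP).
by apply: eq_bigr => j _; rewrite (lmodAM lactP).
Qed.

Lemma lact_tens_inj (T T' : tensor (btri_r ds) ml) :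
  (forall u, tlift (fun (psi : V) m => ml (psi u) m) T =
             tlift (fun (psi : V) m => ml (psi u) m) T') -> T = T'.
Proof.
apply: (dual_tens_inj ef); [exact: lmodAM mlP|exact: lmodADr mlP|exact: lmodADl mlP].
Qed.

Lemma pair_dual_comodule : is_left_comodule (W := Ud) pair_dual_coact.
Proof.
split=> //.
- move=> m m'; rewrite /pair_dual_coact -big_split; apply: eq_bigr => j _.
  by rewrite (lmodADr lactP) tensDr.
- move=> a m; apply: lact_tens_inj => u; have eb := balanced_lact_eval u.
  rewrite (tlift_tlift _ _ eb) [LHS]pair_dual_coactE -(lmodAM lactP).
  rewrite -pair_dual_coactE; apply: eq_tlift => psi m0.
  by rewrite (tlift_tens eb) [in RHS]dual_mul_t_r.
- move=> m.
  (* In U_* ⊗ (U_* ⊗ M) both factors U_* can be tested one after the other, at v and then at u. The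
     outer test requires the module laws of the A-action on the inner tensor; evaluated at u, this
     action by a replaces u by u s(a). *)
  set nl : A -> tensor (btri_r ds) ml -> tensor (btri_r ds) ml := tensl (btri_l dt).
  have evD u : {morph (fun T : tensor (btri_r ds) ml =>
      tlift (fun (psi : V) m => ml (psi u) m) T) : x y / x + y}.
    exact: tliftD (balanced_lact_eval u).
  have nlE a T u : tlift (fun (psi : V) m => ml (psi u) m) (nl a T) =
      tlift (fun (psi : V) m => ml (psi (u * s a)) m) T.
    rewrite (tlift_tlift _ _ (balanced_lact_eval u)); apply: eq_tlift => psi m0.
    by rewrite (tlift_tens (balanced_lact_eval u)) /btri_l dual_mul_t_r.
  have nlM a b T : nl (a * b) T = nl a (nl b T).
    by apply: lact_tens_inj => u; rewrite !nlE rmorphM mulrA.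
  have nlDr a T T' : nl a (T + T') = nl a T + nl a T'.
    by apply: lact_tens_inj => u; rewrite evD !nlE evD.
  have nlDl a b T : nl (a + b) T = nl a T + nl b T.
    apply: lact_tens_inj => u; rewrite evD !nlE raddfD mulrDr -tlift_split.
    by apply: eq_tlift => psi m0; rewrite dualD (lmodADl mlP).
  apply: (dual_tens_inj ef nlM nlDr nlDl) => v; apply: lact_tens_inj => u.
  have b3 : balanced (btri_r ds) nl (fun (psi : V) T => nl (psi v) T).
    split=> [x x' T|x T T'|x a T] //; first exact: nlDl.
    by rewrite /btri_r dual_mul_s_r nlM.
  rewrite !(tlift_tlift _ _ b3) !(tlift_tlift _ _ (balanced_lact_eval u)).
  (* At (v, u) the coproduct side gives (u v) m and the iterated coaction gives u (v m). *)
  transitivity (lact (u * v) m).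
    rewrite -pair_dual_coactE; apply: eq_tlift => psi m0.
    rewrite (tlift_tlift _ _ b3) (tlift_tlift _ _ (balanced_lact_eval u)).
    rewrite -(dual_coprodE U_fgp psi u v) (morph_tlift (F := fun a => ml a m0)).
      apply: eq_tlift => psi1 psi2.
      by rewrite (tlift_tens b3) nlE (tlift_tens (balanced_lact_eval _)).
    by move=> a b; apply: lmodADl mlP _ _ _.
  rewrite (lmodAM lactP) -[lact v m]pair_dual_coactE.
  rewrite (morph_tlift (F := lact u)); last exact: lmodADr.
  apply: eq_tlift => psi m0.
  by rewrite (tlift_tens b3) nlE -(lmodAM lactP) -[LHS]pair_dual_coactE.
- by move=> m; have := pair_dual_coactE 1 m; rewrite (lmodA1 lactP).
Qed.

Lemma pair_rl_YD : is_rl_YD pair_rl.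
Proof.
have lamP := pair_dual_comodule.
have actS a m : dual_coact_eval pair_dual_coact (t a) m = ract m (ds a).
  by rewrite pair_dual_coactE (pair_tgt MP).
split=> //=.
- by move=> a m; rewrite -(pair_src MP).
- by move=> a m; rewrite -[LHS]actS (dual_coact_eval_t U_fgp).
move=> m psi; apply: lact_tens_inj => u.
rewrite [LHS](dual_eval_YD_left ractP lamP (pair_src MP)).
rewrite [RHS](dual_eval_YD_right lamP actS).
transitivity (tlift (fun u1 u2 => ract (lact u2 m) (dual_shift psi u1)) (lcoprod L u)).
  by apply: eq_tlift => u1 u2; rewrite pair_dual_coactE.
rewrite (pair_YD MP); apply: eq_tlift => u1 u2; apply: eq_tlift => psi1 psi2.
by rewrite pair_dual_coactE.
Qed.
End YD.

Section Monoid.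
Variables (R : algType k) (lact : U -> R -> R) (ract : R -> V -> R).
Hypothesis RP : is_monoid_pair U_fgp lact ract.

Let ydP := mpair_YD RP.

Lemma pair_rl_monoid : is_rl_monoid (pair_rl lact ract).
Proof.
have lamP := pair_dual_comodule ydP.
split=> /=.
- exact: pair_rl_YD.
- by move=> r r' psi; apply: (mpair_ractM RP).
- exact: mpair_ract1 RP.
- by move=> a b r r'; rewrite (mpair_bilinl RP); apply: (mpair_bilinr RP).
- exact: mpair_balance RP.
- move=> r r'; apply: (lact_tens_inj ydP) => u.
  rewrite [RHS](dual_eval_coactM lamP _ (mpair_bilinl RP) (mpair_balance RP)).
    rewrite [LHS](pair_dual_coactE ydP) (mpair_lactM RP).
    by apply: eq_tlift => u1 u2; rewrite !(pair_dual_coactE ydP).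
  by move=> a r0; rewrite (pair_dual_coactE ydP) (pair_tgt ydP).
- apply: (lact_tens_inj ydP) => u; rewrite [LHS](pair_dual_coactE ydP).
  by rewrite [RHS](tlift_tens (balanced_lact_eval ydP u)) (mpair_lact1 RP).
Qed.

Lemma pair_rl_braided_commutative :
  pair_braided_commutative lact ract e f -> rl_braided_commutative (pair_rl lact ract).
Proof.
move=> bc r r'; rewrite bc.
rewrite [RHS](dual_eval_braiding (pair_dual_coact lact) (pair_right ydP)
  (mpair_balance RP) _ _ ef).
by apply: eq_bigr => j _; rewrite (pair_dual_coactE ydP).
Qed.
End Monoid.
End PairToRightLeft.

Theorem lemma1p3 (k : comPzRingType) (A U R : algType k)
    (L : left_bialgebroid A U) (U_fgp : is_fgp (src_mod L))
    (n : nat) (e : 'I_n -> U) (f : 'I_n -> dual L)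
    (ef : is_dual_basis e f) :
  (forall D : lr_data L R,
     is_lr_monoid D -> lr_braided_commutative D ->
     is_rl_monoid (lr_to_rl U_fgp e f D) /\
     rl_braided_commutative (lr_to_rl U_fgp e f D)) /\
  (forall D : rl_data (dual_bialgebroid U_fgp) R,
     is_rl_monoid D -> rl_braided_commutative D ->
     is_lr_monoid (rl_to_lr e f D) /\
     lr_braided_commutative (rl_to_lr e f D)).
Proof.
split=> D DP bc.
  have RP := lr_monoid_pair U_fgp DP; split.
    exact (pair_rl_monoid ef RP).
  exact (pair_rl_braided_commutative ef RP (lr_pair_braided_commutative ef DP bc)).
have RP := rl_monoid_pair DP; split.
  exact (pair_lr_monoid ef RP).
exact (pair_lr_braided_commutative ef RP (rl_pair_braided_commutative ef DP bc)).
Qed.
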